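(* Define $\sigma,\tau:A\to A$ by \[ \sigma(s,\alpha)=\Bigl(-s,\,-(s^2-1)^2\cdot\frac{\alpha-(2s)^2}{\alpha+(s^2-1)^2}\Bigr),\qquad \tau(s,\alpha)=\Bigl(\frac1s,\,-\frac{1}{s^2}\cdot\frac{4(s^2-1)^2}{\alpha}\Bigr), \] and let $F:A\to B$ be $F(s,\alpha)=(t,\gamma)$ with $t=\frac{s\alpha-2s(s^2-1)}{\alpha+2s^2(s^2-1)}$, $\gamma=t^2(s-\frac1s)^2$. Then: (1) the group $\Gamma$ generated by $\sigma$ and $\tau$ is isomorphic to $\mathbb{Z}/2\mathbb{Z}\times\mathbb{Z}/2\mathbb{Z}$ and acts on $A$; (2) $F\circ\rho=F$ for every $\rho\in\Gamma$; (3) the induced map $A/\Gamma\to B$ is bijective.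
   Context: For $s\in\mathbb{Q}\setminus\{0,\pm1\}$, $E_{1,s}$ is the elliptic curve $y^2=x(x-(2s)^2)(x+(s^2-1)^2)$ over $\mathbb{Q}$. $A$ is the set of pairs $(s,\alpha)\in(\mathbb{Q}^\times)^2$ with $s\neq\pm1$ such that $\alpha(\alpha-(2s)^2)(\alpha+(s^2-1)^2)=\beta^2$ for some $\beta\in\mathbb{Q}$ and the point $(\alpha,\beta)\in E_{1,s}(\mathbb{Q})$ is not a torsion point. $B$ is the set of pairs $(t,\gamma)\in(\mathbb{Q}^\times)^2$ with $t\neq\pm1$ such that $\gamma$, $\gamma-(t^2-1)^2$, $\gamma+(2t)^2$ are all squares of nonzero rationals. The maps $\sigma,\tau$ are well-defined maps $A\to A$.
   Formalization: The first coordinate of τ(s,α) is taken to be −1/s instead of the printed 1/s; with 1/s one gets F(τ(s,α)) = (−t,γ) with t ≠ 0, so (2) fails, for example at (s,α) = (1/9, 5/9). *)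

(* Defs.v *)
From mathcomp Require Import all_boot all_order all_algebra.
From mathcomp Require Import boolp classical_sets ring.

Set Implicit Arguments.
Unset Strict Implicit.
Unset Printing Implicit Defensive.

Import GRing.Theory Num.Theory.

Local Open Scope classical_set_scope.
Local Open Scope ring_scope.

(* Chord-and-tangent law on y^2 = x^3 + a2 x^2 + a4 x over rat; [None] is the
   point at infinity, the neutral element. The operations are total on
   [option (rat * rat)] and are only meaningful on points of a nonsingular
   curve. The tangent slope is used only when x1 = x2 and y1 <> - y2, which on
   the curve means P = Q and y1 <> 0. *)
Section GroupLaw.
Variables a2 a4 : rat.

Definition ec_add (P Q : option (rat * rat)) : option (rat * rat) :=
  match P, Q with
  | None, _ => Q
  | _, None => P
  | Some (x1, y1), Some (x2, y2) =>
    if (x1 == x2) && (y1 == - y2) then None else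
    let l := if x1 == x2 then (3 * x1 ^+ 2 + 2 * a2 * x1 + a4) / (2 * y1)
             else (y2 - y1) / (x2 - x1) in
    let x3 := l ^+ 2 - a2 - x1 - x2 in
    Some (x3, l * (x1 - x3) - y1)
  end.

Definition ec_mul (n : nat) (P : option (rat * rat)) := iter n (ec_add P) None.

Definition ec_torsion (P : option (rat * rat)) : Prop :=
  exists2 n : nat, (0 < n)%N & ec_mul n P = None.

End GroupLaw.

Definition E1_eq (s x y : rat) : Prop :=
  x * (x - (2 * s) ^+ 2) * (x + (s ^+ 2 - 1) ^+ 2) = y ^+ 2.

Definition E1_a2 (s : rat) : rat := (s ^+ 2 - 1) ^+ 2 - (2 * s) ^+ 2.
Definition E1_a4 (s : rat) : rat := - ((2 * s) ^+ 2 * (s ^+ 2 - 1) ^+ 2).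

Lemma E1_weierstrass (s x y : rat) :
  E1_eq s x y <-> y ^+ 2 = x ^+ 3 + E1_a2 s * x ^+ 2 + E1_a4 s * x.
Proof.
suff -> : x ^+ 3 + E1_a2 s * x ^+ 2 + E1_a4 s * x =
          x * (x - (2 * s) ^+ 2) * (x + (s ^+ 2 - 1) ^+ 2) by split.
rewrite /E1_a2 /E1_a4; set a := (2 * s) ^+ 2; set b := (s ^+ 2 - 1) ^+ 2.
by ring.
Qed.

Definition E1_torsion (s x y : rat) : Prop :=
  ec_torsion (E1_a2 s) (E1_a4 s) (Some (x, y)).

Definition setA : set (rat * rat) :=
  [set p | let: (s, alpha) := p in
    [/\ s != 0, alpha != 0, s != 1, s != -1 &
        exists2 beta : rat, E1_eq s alpha beta & ~ E1_torsion s alpha beta]].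

Definition nonzero_square (x : rat) : Prop := exists2 r : rat, r != 0 & x = r ^+ 2.

Definition setB : set (rat * rat) :=
  [set p | let: (t, gamma) := p in
    [/\ [/\ t != 0, gamma != 0, t != 1 & t != -1],
        nonzero_square gamma,
        nonzero_square (gamma - (t ^+ 2 - 1) ^+ 2) &
        nonzero_square (gamma + (2 * t) ^+ 2)]].

(* In rat, x / 0 = 0. A vanishing denominator below would produce a pair with
   a zero coordinate, which belongs neither to setA nor to setB; hence maps
   setA -> setA and setA -> setB given by these formulas have nonvanishing
   denominators on setA. *)
Definition sigma_formula (p : rat * rat) : rat * rat :=
  let: (s, alpha) := p in
  (- s, - (s ^+ 2 - 1) ^+ 2 *
          ((alpha - (2 * s) ^+ 2) / (alpha + (s ^+ 2 - 1) ^+ 2))).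

(* The source prints the first coordinate as 1 / s. With that sign
   F (tau (s, alpha)) = (- t, gamma) whenever F (s, alpha) = (t, gamma), so
   F is not invariant: (1/9, 5/9) in setA has t = 9/17, its printed image
   (9, -5120/9) has t = -9/17. The sign below is the one that makes F
   invariant; E_{1,s} depends on s only through s^2, so this tau maps setA to
   itself exactly when the printed one does. *)
Definition tau_formula (p : rat * rat) : rat * rat :=
  let: (s, alpha) := p in
  (- (1 / s), - (1 / s ^+ 2) * (4 * (s ^+ 2 - 1) ^+ 2 / alpha)).

Definition F_formula (p : rat * rat) : rat * rat :=
  let: (s, alpha) := p in
  let t := (s * alpha - 2 * s * (s ^+ 2 - 1)) /
           (alpha + 2 * s ^+ 2 * (s ^+ 2 - 1)) in
  (t, t ^+ 2 * (s - 1 / s) ^+ 2).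

Section MapGroups.
Variable T : Type.

(* Such a G acts on T by evaluation: id . a = a, (f \o g) . a = f . (g . a). *)
Definition bijection_group (G : set (T -> T)) : Prop :=
  [/\ G id,
      forall f g, G f -> G g -> G (f \o g) &
      forall f, G f -> exists2 g, G g & cancel f g /\ cancel g f].

(* If some element of S is not bijective, no bijection_group contains S and
   the intersection [smallest] is the set of all maps. *)
Definition generated_group (S : set (T -> T)) : set (T -> T) :=
  smallest bijection_group S.

Definition isomorphic_Z2xZ2 (G : set (T -> T)) : Prop :=
  exists phi : 'Z_2 * 'Z_2 -> (T -> T),
    [/\ injective phi, range phi = G &
        forall u v, phi (u + v) = phi u \o phi v].

Definition map_orbit (G : set (T -> T)) (a : T) : set T :=
  [set f a | f in G].

Definition orbit_space (G : set (T -> T)) : Type := range (map_orbit G).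

Definition orbit_class (G : set (T -> T)) (a : T) : orbit_space G :=
  SigSub (mem_set (imageT (map_orbit G) a)).

End MapGroups.

(* Main.v *)
(* By the substitution (s, alpha) -> (s, t), a point of E_{1,s} with nonzero
   ordinate amounts to a value of t making (t^2 s^2 - 1)(s^2 - t^2) a nonzero
   square, and the fibres of F come from the four s with the same (s - 1/s)^2.
   What remains is that the torsion of E_{1,s}(Q) consists exactly of the points
   excluded by t <> +-1 and nonzero squares: those of order dividing 2 and the
   points x = A^2 +- A C of order 4, with (A, B, C) = (2s, s^2 - 1, s^2 + 1).

   Mazur's theorem is not needed for this. If P is torsion, the sequence 2^j P is
   eventually periodic. If it reaches the origin without P being as above, some
   point of order 4 is a double, so that A is a square up to sign and C is a
   square. If it does not, it is a periodic sequence of doubles, and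
   x = u^2, x - A^2 = v^2, x + B^2 = w^2 along it. At each prime q, doubling acts
   on the valuations of u, v, w like a tent map, with denominators never
   cancelling again; periodicity then forces the valuation of u / v to be even,
   so u / v = +-r^2 and r^4 - 1 = (A / v)^2. Both cases contradict Fermat's
   theorem on x^4 = y^4 + z^2. *)
Require Import Defs.
From mathcomp Require Import all_boot all_order all_algebra.
From mathcomp Require Import boolp classical_sets.
From mathcomp Require Import cyclic ring lra zify.

Set Implicit Arguments.
Unset Strict Implicit.
Unset Printing Implicit Defensive.

Import Order.TTheory GRing.Theory Num.Theory.

(** * Fermat: fourth powers differing by a square *)

(** Induction on a bound for [n]: the least prime factor p occurs to an even power, so p^2 divides n
    and the quotient inherits the hypothesis. *)
Lemma even_logn_square n : (0 < n)%N -> (forall p, prime p -> ~~ odd (logn p n)) ->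
  exists m, n = (m ^ 2)%N.
Proof.
elim: n {-2}n (leqnn n) => [|b IHb] n lenb n0 ev; first by lia.
have [n1|n1] := leqP n 1; first by exists 1%N; lia.
have pr := pdiv_prime n1; set p := pdiv n in pr.
have dv : (p ^ 2 %| n)%N.
  rewrite pfactor_dvdn //; have := ev _ pr.
  have : (0 < logn p n)%N by rewrite logn_gt0 mem_primes pr n0 pdiv_dvd.
  by case: (logn p n) => [|[|?]].
have p2 : (1 < p ^ 2)%N by rewrite -{1}(exp1n 2) ltn_exp2r // prime_gt1.
case: (IHb (n %/ p ^ 2)%N).
- by have := ltn_Pdiv p2 n0; lia.
- by rewrite divn_gt0 ?(dvdn_leq n0 dv) //; lia.
- move=> q prq; have := ev _ prq.
  rewrite -{1}(divnK dv) lognM //; first last.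
  + by rewrite expn_gt0 prime_gt0.
  + by rewrite divn_gt0 ?(dvdn_leq n0 dv) //; lia.
  by rewrite lognX oddD oddM /= addbF.
by move=> m em; exists (m * p)%N; rewrite -(divnK dv) em expnMn.
Qed.

Lemma coprime_mul_square a b c : (0 < a * b)%N -> coprime a b ->
  (a * b = c ^ 2)%N -> exists d, a = (d ^ 2)%N.
Proof.
rewrite muln_gt0 => /andP[a0 b0] co e; apply: even_logn_square => // p pr.
have : ~~ odd (logn p (a * b)) by rewrite e lognX oddM.
rewrite lognM // oddD; case: (posnP (logn p a)) => [-> //|].
rewrite logn_gt0 mem_primes pr a0 /= => pa.
have -> : logn p b = 0%N.
  apply/eqP; rewrite -leqn0 leqNgt logn_gt0 mem_primes pr b0 /=.
  apply/negP => pb; have : (p %| gcdn a b)%N by rewrite dvdn_gcd pa.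
  by rewrite (eqP co) dvdn1 => /eqP p1; rewrite p1 in pr.
by rewrite addbF.
Qed.

(** As a and c are odd, (c + a) / 2 and (c - a) / 2 are integers; they are coprime with product (b /
    2)^2, hence squares m^2 and n^2. *)
Lemma pythagorean_param a b c : (0 < a)%N -> (0 < b)%N -> coprime a b -> ~~ odd b ->
  (a ^ 2 + b ^ 2 = c ^ 2)%N ->
  exists m n, [/\ coprime m n, (n < m)%N, (a + n ^ 2 = m ^ 2)%N, b = (2 * m * n)%N
    & (c = m ^ 2 + n ^ 2)%N].
Proof.
move=> a0 b0 co eb e.
have oa : odd a.
  rewrite -[odd a]negbK; apply/negP => ea; have : (2 %| gcdn a b)%N.
    by rewrite dvdn_gcd !dvdn2 ea eb.
  by rewrite (eqP co).
have oc : odd c by have /(congr1 odd) := e; rewrite oddD !oddX /= oa (negPf eb) /=.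
have ac : (a < c)%N by rewrite -(@ltn_exp2r _ _ 2) // -e; nia.
pose u := ((c - a) ./2)%N; pose v := ((c + a) ./2)%N; pose h := (b ./2)%N.
have eu : (c = a + 2 * u)%N by rewrite /u; lia.
have ev : (v = a + u)%N by rewrite /v; lia.
have eh : (b = 2 * h)%N by rewrite /h; lia.
have euv : (v * u = h ^ 2)%N by nia.
have u0 : (0 < u)%N by lia.
have couv : coprime v u.
  rewrite ev; apply: contraLR co => nco.
  have : (0 < gcdn (a + u) u)%N by rewrite gcdn_gt0 u0 orbT.
  rewrite leq_eqVlt eq_sym; have -> /= : (gcdn (a + u) u == 1%N) = false by apply: negPf.
  move=> /pdivP[p pr pd]; rewrite dvdn_gcd in pd; case/andP: pd => p1 p2.
  have pa : (p %| a)%N by rewrite -(dvdn_addl _ p2).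
  have pb : (p %| b)%N.
    rewrite eh; apply: dvdn_mull; have : (p %| h ^ 2)%N by rewrite -euv dvdn_mull.
    by rewrite Euclid_dvdX // => /andP[].
  apply/negP => /eqP g1; have : (p %| gcdn a b)%N by rewrite dvdn_gcd pa.
  by rewrite g1 dvdn1 => /eqP p11; rewrite p11 in pr.
have uv0 : (0 < v * u)%N by rewrite muln_gt0 u0 andbT; lia.
have [m em] := coprime_mul_square uv0 couv euv.
have [n en] : exists n, u = (n ^ 2)%N.
  by apply: (@coprime_mul_square u v h); rewrite 1?mulnC // coprime_sym.
exists m, n; split.
- by move: couv; rewrite em en coprime_pexpl // coprime_pexpr.
- by rewrite -(@ltn_exp2r _ _ 2) // -em -en; lia.
- by rewrite -em -en; lia.
- rewrite eh -mulnA; congr (2 * _)%N; apply/eqP; rewrite -(@eqn_exp2r _ _ 2) //.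
  by rewrite -euv em en expnMn.
- by rewrite -em -en; lia.
Qed.

(** Infinite descent on [x], run as an induction on a bound [b]: each case ends in a solution whose
    first entry is smaller. *)
Lemma no_fermat42 x y z : (0 < y)%N -> (0 < z)%N -> (x ^ 4 <> y ^ 4 + z ^ 2)%N.
Proof.
elim: x {-2}x (leqnn x) y z => [|b IHb] x lexb y z y0 z0 e; first by nia.
have xy : (y < x)%N by rewrite -(@ltn_exp2r _ _ 4) // e; nia.
have [g1|g1] := leqP (gcdn x y) 1; last first.
  (* A common prime p of x and y has p^4 dividing z^2, so (x / p, y / p, z / p^2) is a smaller
     solution. *)
  have [p pr] := pdivP g1; rewrite dvdn_gcd => /andP[/dvdnP[x' ex] /dvdnP[y' ey]].
  have p0 := prime_gt0 pr; have p1 := prime_gt1 pr.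
  have /dvdnP[z' ez] : (p ^ 2 %| z)%N.
    rewrite -(@dvdn_pexp2r _ _ 2) //.
    by rewrite -(@dvdn_addr (y ^ 4)) -?e ?ex ?ey expnMn -expnM dvdn_mull.
  have x'b : (x' <= b)%N by rewrite ex in lexb xy; nia.
  have y'0 : (0 < y')%N by rewrite ey in y0; nia.
  have z'0 : (0 < z')%N by rewrite ez in z0; nia.
  have pp : (0 < p ^ 4)%N by rewrite expn_gt0 p0.
  apply: (IHb x' x'b y' z' y'0 z'0); apply/eqP.
  rewrite -(eqn_pmul2r pp) mulnDl -!expnMn -ex -ey e ez expnMn -expnM.
  by [].
have {g1} co : coprime x y by rewrite /coprime eqn_leq g1 gcdn_gt0 y0 orbT.
have cox2 : coprime (x ^ 2) (y ^ 2) by rewrite coprimeXl ?coprimeXr.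
have e2 : (z ^ 2 + (y ^ 2) ^ 2 = (x ^ 2) ^ 2)%N by rewrite -!expnM e addnC.
have coyz : coprime (y ^ 2) z.
  have : coprime (y ^ 4) (x ^ 4) by rewrite coprimeXl ?coprimeXr // coprime_sym.
  rewrite e /coprime gcdnDl -/(coprime _ _) coprime_pexpr // => h.
  by apply: coprimeXl; rewrite coprime_pexpl in h.
(* Parametrising the triple (d^2, 2 c^2, x) gives f g = c^2 with f, g coprime; so f = f'^2, g = g'^2
   and f'^4 = g'^4 + d^2 with f' < x. *)
have key c d : (0 < c)%N -> (0 < d)%N -> odd d -> coprime c d ->
    (x ^ 2 <> 4 * c ^ 4 + d ^ 4)%N.
  move=> c0 d0 od cocd ex.
  have co2 : coprime (d ^ 2) (2 * c ^ 2).
    by rewrite coprimeXl // coprimeMr coprimen2 od coprimeXr // coprime_sym.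
  have ev2 : ~~ odd (2 * c ^ 2) by rewrite oddM.
  have d20 : (0 < d ^ 2)%N by rewrite expn_gt0 d0.
  have c20 : (0 < 2 * c ^ 2)%N by rewrite muln_gt0 expn_gt0 c0.
  have exx : ((d ^ 2) ^ 2 + (2 * c ^ 2) ^ 2 = x ^ 2)%N by rewrite ex; lia.
  have [f [g [cofg ltgf e1 e2' e3]]] := pythagorean_param d20 c20 co2 ev2 exx.
  have efg : (f * g = c ^ 2)%N by lia.
  have fg0 : (0 < f * g)%N by rewrite efg expn_gt0 c0.
  have [f' ef] := coprime_mul_square fg0 cofg efg.
  have [g' eg] : exists g', g = (g' ^ 2)%N.
    by apply: (@coprime_mul_square g f c); rewrite 1?mulnC // coprime_sym.
  have g0 : (0 < g')%N by move: fg0; rewrite eg; case: (g') => //; rewrite muln0.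
  have f0 : (0 < f')%N by move: fg0; rewrite ef; case: (f').
  apply: (IHb f' _ g' d) => //; last by rewrite ef eg in e1; lia.
  rewrite -ltnS; apply: leq_trans lexb; rewrite e3 ef eg -!expnM.
  have f4 : (f' <= f' ^ 4)%N by rewrite -{1}(expn1 f') leq_pexp2l.
  have g4 : (0 < g' ^ 4)%N by rewrite expn_gt0 g0.
  by rewrite -addn1; apply: leq_add.
(* For y even, the triple (z, y^2, x^2) gives y^2 = 2 m n and x^2 = m^2 + n^2. The even one of m, n
   is 2 c^2 and the other is d^2, which [key] excludes. *)
have [oy|ey] := boolP (odd y); last first.
  have ox : odd x.
    rewrite -[odd x]negbK; apply/negP => ex; have : (2 %| gcdn x y)%N.
      by rewrite dvdn_gcd !dvdn2 ex ey.
    by rewrite (eqP co).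
  have y20 : (0 < y ^ 2)%N by rewrite expn_gt0 y0.
  have coyz' : coprime z (y ^ 2) by rewrite coprime_sym.
  have ey2 : ~~ odd (y ^ 2) by rewrite oddX.
  have [m [n [comn ltmn e1 e3 e4]]] := pythagorean_param z0 y20 coyz' ey2 e2.
  have oddmn : odd m (+) odd n by have /(congr1 odd) := e4; rewrite oddD !oddX ox.
  have n0 : (0 < n)%N by move: y20; rewrite e3; case: (n) => //; rewrite muln0.
  have m0 : (0 < m)%N by lia.
  have exmn : (x ^ 2 = m ^ 2 + n ^ 2)%N by [].
  have main a b' : (0 < a)%N -> (0 < b')%N -> odd b' -> coprime a b' ->
     (y ^ 2 = 2 * (a * b') -> x ^ 2 = a ^ 2 + b' ^ 2 -> ~~ odd a -> False)%N.
    move=> a0 b'0 ob coab yab xab ea.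
    have [a' ea'] : exists a', (a = 2 * a')%N by exists (a./2); lia.
    have [y' ey'] : exists y', (y = 2 * y')%N by exists (y./2); lia.
    have a'0 : (0 < a')%N by lia.
    have eab : (a' * b' = y' ^ 2)%N by move: yab; rewrite ea' ey' expnMn; lia.
    have coab' : coprime a' b' by move: coab; rewrite ea' coprimeMl => /andP[].
    have ab0 : (0 < a' * b')%N by rewrite muln_gt0 a'0.
    have [c ec] := coprime_mul_square ab0 coab' eab.
    have [d ed] : exists d, b' = (d ^ 2)%N.
      by apply: (@coprime_mul_square b' a' y'); rewrite 1?mulnC // coprime_sym.
    apply: (key c d).
    - by move: a'0; rewrite ec; case: (c).
    - by move: b'0; rewrite ed; case: (d).
    - by move: ob; rewrite ed oddX.
    - by move: coab'; rewrite ec ed coprime_pexpl // coprime_pexpr.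
    - by rewrite xab ea' ec ed; lia.
  case em : (odd m) oddmn => /=; last first.
    by move=> on; apply: (main m n) => //; rewrite ?em // mulnA.
  move=> on; apply: (main n m) => //; first by rewrite coprime_sym.
    by rewrite (mulnC n) mulnA.
  by rewrite addnC.
(* With y and z odd, y^4 + z^2 would be 2 modulo 4, which is no fourth power. *)
have ez : ~~ odd z.
  apply/negP => oz; have := congr1 (modn^~ 4) e.
  have m4 t : odd t -> (t ^ 2 %% 4 = 1)%N.
    move=> ot; have -> : (t ^ 2 = 4 * (t./2 ^ 2 + t./2) + 1)%N by nia.
    by rewrite mulnC modnMDl.
  have -> : (y ^ 4 + z ^ 2) %% 4 = 2.
    by rewrite -modnDm (m4 _ oz) -[4%N]/(2 * 2)%N expnM m4 // oddX oy.
  have [ox|ex] := boolP (odd x); first by rewrite -[4%N]/(2 * 2)%N expnM m4 // oddX ox.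
  have -> : (x = 2 * x./2)%N by lia.
  by rewrite expnMn -modnMml.
have y20 : (0 < y ^ 2)%N by rewrite expn_gt0 y0.
have e2' : ((y ^ 2) ^ 2 + z ^ 2 = (x ^ 2) ^ 2)%N by rewrite addnC.
(* Now y^2 = m^2 - n^2 and x^2 = m^2 + n^2, hence m^4 = n^4 + (x y)^2 with m < x. *)
have [m [n [comn ltmn e1 e3 e4]]] := pythagorean_param y20 z0 coyz ez e2'.
have n0 : (0 < n)%N by move: z0; rewrite e3; case: (n) => //; rewrite muln0.
apply: (IHb m _ n (x * y)%N); rewrite ?muln_gt0 ?n0 ?y0 ?andbT //; first by nia.
  by lia.
have -> : ((x * y) ^ 2 = (m ^ 2 + n ^ 2) * y ^ 2)%N by rewrite expnMn e4.
by apply/eqP; rewrite -(eqn_add2l (n ^ 4)); apply/eqP; nia.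
Qed.

(** * Valuations along a periodic doubling sequence *)

Local Open Scope ring_scope.

(** From [i] one climbs to [j + i * N], which is at least [i], then drops to [j] by whole
    periods. *)
Lemma periodic_stable (S : nat -> Prop) (N i j : nat) : (0 < N)%N ->
  (forall k, S k -> S k.+1) -> (forall k, S (k + N)%N -> S k) -> S i -> S j.
Proof.
move=> N0 st per si.
have up k : S (i + k)%N by elim: k => [|k IHk]; rewrite ?addn0 // addnS; apply: st.
have down k : S (j + k * N)%N -> S j.
  by elim: k => [|k IHk]; rewrite ?addn0 // mulSnr addnA => /per.
by apply: (down i); have := up (j + i * N - i)%N; rewrite subnKC //; nia.
Qed.

(* The constraint [x + y = z] puts on the valuations of its terms. *)
Definition ultra (x y z : int) : Prop :=
  (x < y /\ z = x) \/ (y < x /\ z = y) \/ (x = y /\ x <= z).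

(** The valuations at one prime of the roots r1, r2, r3 of a [doubling_orbit], up to a common shift.
    Here [c] is that of 2 and the dij are those of ei - ej, shifted accordingly. The steps read off
    2 r1 r2 r3 ri' = +-(ri^4 - (ei - ej)(ei - ek)), where ri' is the next root. *)
Record val_orbit (c d12 d13 d23 : int) (a1 a2 a3 : nat -> int) (N : nat) : Prop :=
  ValOrbit {
  vo_pos : (0 < N)%N;
  vo_per1 : forall j, a1 (j + N)%N = a1 j;
  vo_per2 : forall j, a2 (j + N)%N = a2 j;
  vo_per3 : forall j, a3 (j + N)%N = a3 j;
  vo_d12 : forall j, ultra (2 * a1 j) (2 * a2 j) d12;
  vo_d13 : forall j, ultra (2 * a1 j) (2 * a3 j) d13;
  vo_d23 : forall j, ultra (2 * a2 j) (2 * a3 j) d23;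
  vo_step1 : forall j,
    ultra (4 * a1 j) (d12 + d13) (c + a1 j + a2 j + a3 j + a1 j.+1);
  vo_step2 : forall j,
    ultra (4 * a2 j) (d12 + d23) (c + a1 j + a2 j + a3 j + a2 j.+1);
  vo_step3 : forall j,
    ultra (4 * a3 j) (d13 + d23) (c + a1 j + a2 j + a3 j + a3 j.+1) }.

Section ValOrbit.
Variables (c h : int) (a1 a2 a3 : nat -> int) (N : nat).
Hypotheses (c0 : 0 <= c) (h0 : 0 <= h).
Hypothesis vo : val_orbit c (2 * h) 0 0 a1 a2 a3 N.

Local Ltac facts j := 
  move: (vo_d12 vo j) (vo_d13 vo j) (vo_d23 vo j)
   (vo_step1 vo j) (vo_step2 vo j) (vo_step3 vo j); rewrite /ultra.

Local Ltac diffs j := move: (vo_d12 vo j) (vo_d13 vo j) (vo_d23 vo j); rewrite /ultra.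

(** For a common value a < 0 the term ri^4 dominates, so 4 a = c + 3 a + a' for each next value
    a'. *)
Lemma val_orbit_neg_step j : a1 j = a2 j -> a2 j = a3 j -> a1 j < 0 ->
  [/\ a1 j.+1 = a1 j - c, a2 j.+1 = a1 j - c & a3 j.+1 = a1 j - c].
Proof.
move=> e12 e23 neg; split.
- by move: (vo_step1 vo j); rewrite /ultra; lia.
- by move: (vo_step2 vo j); rewrite /ultra; lia.
- by move: (vo_step3 vo j); rewrite /ultra; lia.
Qed.

(** As the dij are nonnegative, one negative value forces all three to agree. This persists at the
    next index, and periodicity carries it back to every index. *)
Lemma val_orbit_neg i : a1 i < 0 \/ a2 i < 0 \/ a3 i < 0 ->
  forall j, [/\ a1 j = a2 j, a2 j = a3 j & a1 j < 0].
Proof.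
move=> hi j; apply: (@periodic_stable
  (fun j => [/\ a1 j = a2 j, a2 j = a3 j & a1 j < 0]) N i j (vo_pos vo)).
- by move=> k [e1 e2 neg]; have [-> -> ->] := val_orbit_neg_step e1 e2 neg; split; lia.
- by move=> k; rewrite (vo_per1 vo) (vo_per2 vo) (vo_per3 vo).
- by diffs i; split; lia.
Qed.

(** A negative value would drop by [c] at every step, against periodicity. *)
Lemma val_orbit_nonneg_int : 0 < c -> forall j, [/\ 0 <= a1 j, 0 <= a2 j & 0 <= a3 j].
Proof.
move=> c1 j.
case: (boolP [&& 0 <= a1 j, 0 <= a2 j & 0 <= a3 j]) => [/and3P//|].
rewrite !negb_and -!ltNge => hneg; exfalso.
have neg := @val_orbit_neg j _; have {}neg := neg ltac:(lia).
have dec k : a1 (j + k)%N = a1 j - k%:Z * c.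
  elim: k => [|k IHk]; first by rewrite addn0; lia.
  by rewrite addnS; have [e1 e2 lt] := neg (j + k)%N;
    have [-> _ _] := val_orbit_neg_step e1 e2 lt; rewrite IHk; lia.
by have := dec N; rewrite (vo_per1 vo); have := vo_pos vo; nia.
Qed.

(** When the values are nonnegative, a3 vanishes and a1 = a2 = a evolves by the tent map a -> min(2
    a, 2 h - 2 a), whose values are even; by periodicity every a is a value of this map. *)
Lemma val_orbit_odd : c = 0 -> forall j,
  (a1 j = a2 j /\ a2 j = a3 j) \/ (a3 j = 0 /\ exists k, a1 j = 2 * k /\ a2 j = 2 * k).
Proof.
move=> cz j.
case: (boolP [&& 0 <= a1 j, 0 <= a2 j & 0 <= a3 j]); last first.
  rewrite !negb_and -!ltNge => hneg; left.
  by have [] := @val_orbit_neg j ltac:(lia) j.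
move=> nnj; right.
have nn i : [/\ 0 <= a1 i, 0 <= a2 i & 0 <= a3 i].
  case: (boolP [&& 0 <= a1 i, 0 <= a2 i & 0 <= a3 i]) => [/and3P//|].
  rewrite !negb_and -!ltNge => hneg.
  by have [] := @val_orbit_neg i ltac:(lia) j; lia.
have a3z i : a3 i = 0.
  have [? ? ?] := nn i; have [? ? ?] := nn i.+1.
  by facts i; lia.
have [hz|hp] : h = 0 \/ 0 < h by lia.
  have [? ? ?] := nn j; have [? ? ?] := nn j.+1.
  have := a3z j; have := a3z j.+1.
  by facts j; split; [|exists 0]; lia.
(* A value at least h > 0 would be followed by zeros forever, hence be zero itself by
   periodicity. *)
have small i : a1 i < h /\ a2 i < h.
  case: (boolP ((a1 i < h) && (a2 i < h))) => [/andP//|big].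
  have z1 : a1 i.+1 = 0 /\ a2 i.+1 = 0.
    have [? ? ?] := nn i; have [? ? ?] := nn i.+1; have := a3z i.
    by facts i; lia.
  have : a1 i = 0 /\ a2 i = 0.
    apply: (@periodic_stable (fun j => a1 j = 0 /\ a2 j = 0) N i.+1 i (vo_pos vo)) => //.
    - move=> k [? ?]; have [? ? ?] := nn k; have [? ? ?] := nn k.+1; have := a3z k.
      by facts k; lia.
    - by move=> k; rewrite (vo_per1 vo) (vo_per2 vo).
  by lia.
(* Since i + 1 = j + N, the values at [j] are the images of those at [i]. *)
have [i ei1 ei2] : exists2 i, a1 i.+1 = a1 j & a2 i.+1 = a2 j.
  exists (j + N.-1)%N; rewrite -addnS prednK ?(vo_pos vo) //.
    exact: vo_per1 vo j. exact: vo_per2 vo j.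
have [? ?] := small i; have [? ?] := small i.+1.
have [? ? ?] := nn i; have [? ? ?] := nn i.+1; have := a3z i; have := a3z i.+1.
rewrite -ei1 -ei2 => ? ?; split; first exact: a3z.
have e12 : a1 i = a2 i by diffs i; lia.
move: (vo_step1 vo i) (vo_step2 vo i); rewrite /ultra => st1 st2.
(* The rising and the falling branch of the tent map; equality in the second is excluded by the
   bound [small] at i + 1. *)
have [lt|ge] : 2 * a1 i < h \/ h <= 2 * a1 i by lia.
  by exists (a1 i); lia.
by exists (h - a1 i); lia.
Qed.

(** If a1 and a2 differed, their minimum would be h > 0, so a3 = 0. The step at the smaller one
    would then express 2 h as 1 + a1 + a2 plus a nonnegative number, although a1 + a2 > 2 h. *)
Lemma val_orbit_two_good : c = 1 -> 0 < h -> forall j, a1 j = a2 j.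
Proof.
move=> c1 h1 j; have nn := val_orbit_nonneg_int (ltac:(lia)).
have [? ? ?] := nn j; have [? ? ?] := nn j.+1.
by facts j; lia.
Qed.

(** A positive a3 would force a1 = a2 = 0, and the third step would equate 0 with 1 + a3 plus a
    nonnegative number. *)
Lemma val_orbit_two_bad : c = 1 -> 0 < h -> exists j, a3 j = 0.
Proof.
move=> c1 h1; exists 0%N; have nn := val_orbit_nonneg_int (ltac:(lia)).
have [? ? ?] := nn 0%N; have [? ? ?] := nn 1%N.
by facts 0%N; lia.
Qed.

End ValOrbit.

(** * Valuations of rational numbers *)

(* The value at 0 is the junk value 0. *)
Definition vq (q : nat) (x : rat) : int :=
  (logn q `|numq x|)%:Z - (logn q `|denq x|)%:Z.

Section Valuation.
Variable q : nat.
Hypothesis pr : prime q.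

Lemma vq_frac (a b : int) : a != 0 -> b != 0 ->
  vq q (a%:Q / b%:Q) = (logn q `|a|)%:Z - (logn q `|b|)%:Z.
Proof.
move=> a0 b0; set x := a%:Q / b%:Q.
have x0 : x != 0 by rewrite mulf_neq0 ?invr_eq0 ?intr_eq0.
have n0 : numq x != 0 by rewrite numq_eq0.
have e : (numq x * b = a * denq x)%R.
  apply: (@intr_inj rat); rewrite !intrM.
  apply/eqP; rewrite -eqr_div ?intr_eq0 ?denq_eq0 //.
  by rewrite divq_num_den.
have : (logn q (`|numq x| * `|b|) = logn q (`|a| * `|denq x|))%N.
  by rewrite -!abszM e.
rewrite !lognM ?absz_gt0 ?denq_eq0 // /vq; lia.
Qed.

Lemma vq_int (a : int) : a != 0 -> vq q a%:Q = (logn q `|a|)%:Z.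
Proof.
by move=> a0; rewrite -[a%:Q]divr1 -[1]/(1%:~R) vq_frac //= logn1 subr0.
Qed.

Lemma vqM x y : x != 0 -> y != 0 -> vq q (x * y) = vq q x + vq q y.
Proof.
move=> x0 y0; rewrite -{1}[x]divq_num_den -{1}[y]divq_num_den mulf_div -!intrM.
rewrite vq_frac ?mulf_neq0 ?denq_eq0 ?numq_eq0 //.
rewrite !abszM !lognM ?absz_gt0 ?denq_eq0 ?numq_eq0 // /vq; lia.
Qed.

Lemma vq1 : vq q 1 = 0.
Proof. by rewrite (vq_int (a := 1)) ?logn1. Qed.

Lemma vqV x : x != 0 -> vq q x^-1 = - vq q x.
Proof.
move=> x0; have : vq q (x^-1 * x) = vq q 1 by rewrite mulVf.
by rewrite vqM ?invr_eq0 // vq1; lia.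
Qed.

Lemma vqX x n : x != 0 -> vq q (x ^+ n) = n%:Z * vq q x.
Proof.
move=> x0; elim: n => [|n IHn]; first by rewrite expr0 vq1 mul0r.
by rewrite exprS vqM ?expf_neq0 // IHn; lia.
Qed.

Lemma vqN x : vq q (- x) = vq q x.
Proof. by rewrite /vq numqN denqN abszN. Qed.

Lemma vq_add_int (a b : int) (n : nat) : a != 0 -> b != 0 -> a + b != 0 ->
  (n <= logn q `|a|)%N -> (n <= logn q `|b|)%N -> (n <= logn q `|(a + b)%R|)%N.
Proof.
move=> a0 b0 ab0; rewrite -!pfactor_dvdn ?absz_gt0 // => da db.
have {}da : (Posz (q ^ n) %| a)%Z by [].
have {}db : (Posz (q ^ n) %| b)%Z by [].
by have := rpredD da db.
Qed.

Lemma vqD_ge (n : int) (x y : rat) : x != 0 -> y != 0 -> x + y != 0 ->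
  n <= vq q x -> n <= vq q y -> n <= vq q (x + y).
Proof.
move=> x0 y0 xy0.
have exy : x + y = (numq x * denq y + numq y * denq x)%:Q / (denq x * denq y)%:Q.
  by rewrite !intrD !intrM -addf_div ?intr_eq0 ?denq_eq0 // !divq_num_den.
have s0 : numq x * denq y + numq y * denq x != 0.
  by apply: contraNneq xy0 => e; rewrite exy e mul0r.
rewrite exy vq_frac ?mulf_neq0 ?denq_eq0 //.
have nx : numq x != 0 by rewrite numq_eq0.
have ny : numq y != 0 by rewrite numq_eq0.
rewrite abszM lognM ?absz_gt0 ?denq_eq0 // /vq => hx hy.
set dx := logn q `|denq x| in hx *; set dy := logn q `|denq y| in hy *.
have [neg|] := ltP (n + dx%:Z + dy%:Z) 0; first by lia.
case em : (n + dx%:Z + dy%:Z) => [m|//] _.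
have := @vq_add_int (numq x * denq y) (numq y * denq x) m.
rewrite !mulf_neq0 ?denq_eq0 // !abszM !lognM ?absz_gt0 ?denq_eq0 //.
rewrite -/dx -/dy => /(_ isT isT s0) h.
have h1 : (m <= logn q `|numq x| + dy)%N by lia.
have h2 : (m <= logn q `|numq y| + dx)%N by lia.
move: (h h1 h2); set L := logn q _; clearbody L dx dy => hL.
by clear -em hL; lia.
Qed.

Lemma vq_ultra x y : x != 0 -> y != 0 -> x + y != 0 ->
  ultra (vq q x) (vq q y) (vq q (x + y)).
Proof.
move=> x0 y0 xy0; rewrite /ultra.
have g := vqD_ge x0 y0 xy0.
have gx : forall n, n <= vq q (x + y) -> n <= vq q y -> n <= vq q x.
  move=> n h1 h2; have {1}-> : x = (x + y) + (- y) by ring.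
  by apply: vqD_ge; rewrite ?oppr_eq0 ?vqN ?addrK.
have gy : forall n, n <= vq q (x + y) -> n <= vq q x -> n <= vq q y.
  move=> n h1 h2; have {1}-> : y = (x + y) + (- x) by ring.
  by apply: vqD_ge; rewrite ?oppr_eq0 ?vqN // addrAC subrr add0r.
have [lt|[lt|eq]] : vq q x < vq q y \/ vq q y < vq q x \/ vq q x = vq q y by lia.
- left; split=> //; have ge := g (vq q x) (lexx _) (ltW lt).
  have [h|h] := leP (vq q (x + y)) (vq q x); first by apply/eqP; rewrite eq_le h ge.
  have [h'|h'] := leP (vq q (x + y)) (vq q y).
    by have := gx _ (lexx _) h'; rewrite leNgt h.
  by have := gx _ (ltW h') (lexx _); rewrite leNgt lt.
- right; left; split=> //; have ge := g (vq q y) (ltW lt) (lexx _).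
  have [h|h] := leP (vq q (x + y)) (vq q y); first by apply/eqP; rewrite eq_le h ge.
  have [h'|h'] := leP (vq q (x + y)) (vq q x).
    by have := gy _ (lexx _) h'; rewrite leNgt h.
  by have := gy _ (ltW h') (lexx _); rewrite leNgt lt.
- by right; right; split=> //; apply: g; rewrite // eq.
Qed.

End Valuation.

(** Numerator and denominator are coprime, so the exponents in each of them are even separately. *)
Lemma even_vq_square (x : rat) : x != 0 ->
  (forall q, prime q -> exists k, vq q x = 2 * k) -> exists r, x = r ^+ 2 \/ x = - r ^+ 2.
Proof.
move=> x0 ev.
have sq (a : nat) (b : nat) : (0 < a)%N -> (0 < b)%N -> coprime a b ->
    (forall q, prime q -> exists k, (logn q a)%:Z - (logn q b)%:Z = 2 * k) ->
    exists m, a = (m ^ 2)%N.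
  move=> a0 b0 co evab; apply: even_logn_square => // p pr.
  have [k] := evab p pr.
  have [-> //|] := posnP (logn p a).
  rewrite logn_gt0 mem_primes pr a0 /= => pa.
  have -> : logn p b = 0%N.
    apply/eqP; rewrite -leqn0 leqNgt logn_gt0 mem_primes pr b0 /=.
    apply/negP => pb; have : (p %| gcdn a b)%N by rewrite dvdn_gcd pa.
    by rewrite (eqP co) dvdn1 => /eqP p1; rewrite p1 in pr.
  lia.
have n0 : (0 < `|numq x|)%N by rewrite absz_gt0 numq_eq0.
have d0 : (0 < `|denq x|)%N by rewrite absz_gt0 denq_eq0.
have [m em] := sq _ _ n0 d0 (coprime_num_den x) ev.
have [n en] : exists n, `|denq x|%N = (n ^ 2)%N.
  apply: (sq _ _ d0 n0); first by rewrite coprime_sym coprime_num_den.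
  by move=> q pr; have [k e] := ev q pr; exists (- k); rewrite mulrN -e /vq opprB.
exists (m%:R / n%:R); rewrite expr_div_n -!natrX -em -en.
have -> : (`|denq x|%N)%:R = (denq x)%:~R :> rat.
  by rewrite -[in RHS](gez0_abs (ltW (denq_gt0 x))).
have [e|e] := leP 0 (numq x); [left | right].
- by rewrite -[LHS]divq_num_den -{1}(gez0_abs e).
- by rewrite -[LHS]divq_num_den -mulNr -{1}[numq x]opprK -(ltz0_abs e) rmorphN.
Qed.

(** Clearing denominators: up to sign r = a / b and z = c / d, and (a d)^4 = (b d)^4 + (c b^2
    d)^2. *)
Lemma fermat_rat (r z : rat) : r ^+ 4 - 1 = z ^+ 2 -> z = 0.
Proof.
move=> e; apply/eqP; apply: contraPT (e) => z0 {}e.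
pose a := `|numq r|%N; pose b := `|denq r|%N; pose c := `|numq z|%N; pose d := `|denq z|%N.
have b0 : (0 < b)%N by rewrite absz_gt0 denq_eq0.
have d0 : (0 < d)%N by rewrite absz_gt0 denq_eq0.
have c0 : (0 < c)%N by rewrite absz_gt0 numq_eq0.
apply: (@no_fermat42 (a * d) (b * d) (c * b ^ 2 * d));
  rewrite ?muln_gt0 ?b0 ?c0 ?d0 ?expn_gt0 ?b0 //.
apply/eqP; rewrite -(eqr_nat rat); apply/eqP.
have sqrE (x : rat) : x ^+ 2 = `|numq x|%:R ^+ 2 / `|denq x|%:R ^+ 2.
  have absE (i : int) : `|i|%:R ^+ 2 = i%:~R ^+ 2 :> rat.
    by rewrite natr_absz intr_norm real_normK ?num_real.
  by rewrite !absE -expr_div_n divq_num_den.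
have rE := sqrE r; have zE := sqrE z.
rewrite -/a -/b in rE; rewrite -/c -/d in zE.
rewrite !(natrD, natrM, natrX).
have b0' : b%:R != 0 :> rat by rewrite pnatr_eq0 -lt0n.
have d0' : d%:R != 0 :> rat by rewrite pnatr_eq0 -lt0n.
have : (r ^+ 2) ^+ 2 = 1 + z ^+ 2 by rewrite -exprM -e; ring.
rewrite rE zE => /(congr1 (fun t => t * b%:R ^+ 4 * d%:R ^+ 4)) e'.
transitivity ((a%:R ^+ 2 / b%:R ^+ 2) ^+ 2 * b%:R ^+ 4 * d%:R ^+ 4 : rat); first by field.
by rewrite e'; field.
Qed.

(** * Periodic doubling sequences do not exist *)

(* The square roots [ri j] of [x - ei] along a sequence of points of
   y^2 = (x - e1)(x - e2)(x - e3), each the double of the previous one. *)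
Record doubling_orbit (e1 e2 e3 : rat) (r1 r2 r3 : nat -> rat) (N : nat) : Prop :=
  DoublingOrbit {
  do_pos : (0 < N)%N;
  do_dist : [/\ e1 != e2, e1 != e3 & e2 != e3];
  do_neq0 : forall j, [/\ r1 j != 0, r2 j != 0 & r3 j != 0];
  do_per : forall j, [/\ r1 (j + N)%N ^+ 2 = r1 j ^+ 2,
    r2 (j + N)%N ^+ 2 = r2 j ^+ 2 & r3 (j + N)%N ^+ 2 = r3 j ^+ 2];
  do_sqr : forall j, r1 j ^+ 2 + e1 = r2 j ^+ 2 + e2 /\ r1 j ^+ 2 + e1 = r3 j ^+ 2 + e3;
  do_step : forall j, [/\
    (2 * r1 j * r2 j * r3 j * r1 j.+1) ^+ 2 =
      (r1 j ^+ 4 - (e1 - e2) * (e1 - e3)) ^+ 2,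
    (2 * r1 j * r2 j * r3 j * r2 j.+1) ^+ 2 =
      (r2 j ^+ 4 - (e2 - e1) * (e2 - e3)) ^+ 2 &
    (2 * r1 j * r2 j * r3 j * r3 j.+1) ^+ 2 =
      (r3 j ^+ 4 - (e3 - e1) * (e3 - e2)) ^+ 2] }.

(** Together with [doubling_orbit231], this lets any two of the ei be the close pair, the one whose
    distance has valuation 2 h in [val_orbit_odd]. *)
Lemma doubling_orbit132 e1 e2 e3 r1 r2 r3 N :
  doubling_orbit e1 e2 e3 r1 r2 r3 N -> doubling_orbit e1 e3 e2 r1 r3 r2 N.
Proof.
case=> N0 [d12 d13 d23] nz per sq st; split=> // [|j|j|j|j].
- by split; rewrite // eq_sym.
- by case: (nz j).
- by case: (per j).
- by case: (sq j).
- have -> : 2 * r1 j * r3 j * r2 j = 2 * r1 j * r2 j * r3 j by ring.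
  by case: (st j) => s1 s2 s3; rewrite s1 s2 s3; split; congr (_ ^+ 2); ring.
Qed.

Lemma doubling_orbit231 e1 e2 e3 r1 r2 r3 N :
  doubling_orbit e1 e2 e3 r1 r2 r3 N -> doubling_orbit e2 e3 e1 r2 r3 r1 N.
Proof.
case=> N0 [d12 d13 d23] nz per sq st; split=> // [|j|j|j|j].
- by split; rewrite // eq_sym.
- by case: (nz j).
- by case: (per j).
- by case: (sq j) => <- <-.
- have -> : 2 * r2 j * r3 j * r1 j = 2 * r1 j * r2 j * r3 j by ring.
  by case: (st j) => s1 s2 s3; rewrite s1 s2 s3; split; congr (_ ^+ 2); ring.
Qed.

Lemma ultra_shift (m x y z : int) : ultra x y z -> ultra (x - m) (y - m) (z - m).
Proof. by rewrite /ultra; lia. Qed.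

Lemma vq_ultraB q (x y z : rat) : prime q -> x != 0 -> y != 0 -> z != 0 -> x - y = z ->
  ultra (vq q x) (vq q y) (vq q z).
Proof.
move=> pr x0 y0 z0 e; move: z0; rewrite -e -(vqN q y) => z0; apply: vq_ultra => //.
by rewrite oppr_eq0.
Qed.

(** All relations are homogeneous, with ri of weight 1 and ei of weight 2. Subtracting [m] from the
    valuations of the roots thus normalises two of the distances to valuation 0. *)
Lemma orbit_val e1 e2 e3 r1 r2 r3 N q (h m : int) : prime q ->
  doubling_orbit e1 e2 e3 r1 r2 r3 N ->
  vq q (e1 - e2) = 2 * (m + h) -> vq q (e1 - e3) = 2 * m -> vq q (e2 - e3) = 2 * m ->
  val_orbit (vq q 2) (2 * h) 0 0 (fun j => vq q (r1 j) - m) (fun j => vq q (r2 j) - m)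
    (fun j => vq q (r3 j) - m) N.
Proof.
move=> pr orb d12' d13' d23'.
suff : val_orbit (vq q 2) (vq q (e1 - e2) - 2 * m) (vq q (e1 - e3) - 2 * m)
    (vq q (e2 - e3) - 2 * m) (fun j => vq q (r1 j) - m) (fun j => vq q (r2 j) - m)
    (fun j => vq q (r3 j) - m) N.
  by rewrite d12' d13' d23' !subrr mulrDr addrAC subrr add0r.
case: orb {d12' d13' d23'} => N0 [d12 d13 d23] nz per sq st.
have sqv (a b : rat) : a != 0 -> b != 0 -> a ^+ 2 = b ^+ 2 -> vq q a = vq q b.
  move=> a0 b0 /eqP; rewrite eqf_sqr => /orP[] /eqP -> //; exact: vqN.
have pw (a : rat) : a != 0 -> 2 * (vq q a - m) = vq q (a ^+ 2) - 2 * m.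
  by move=> a0; rewrite vqX //; ring.
have dif (a b ea eb : rat) : a != 0 -> b != 0 -> ea != eb -> a ^+ 2 + ea = b ^+ 2 + eb ->
    ultra (2 * (vq q a - m)) (2 * (vq q b - m)) (vq q (ea - eb) - 2 * m).
  move=> a0 b0 nab e; rewrite !pw //; apply: ultra_shift.
  rewrite -(vqN q (ea - eb)); apply: vq_ultraB; rewrite ?expf_neq0 ?oppr_eq0 ?subr_eq0 //.
  by rewrite -[a ^+ 2](addrK ea) e; ring.
have step (a a' b c ea eb ec : rat) : a != 0 -> b != 0 -> c != 0 -> a' != 0 ->
    ea != eb -> ea != ec ->
    (2 * a * b * c * a') ^+ 2 = (a ^+ 4 - (ea - eb) * (ea - ec)) ^+ 2 ->
    ultra (4 * (vq q a - m)) ((vq q (ea - eb) - 2 * m) + (vq q (ea - ec) - 2 * m))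
      (vq q 2 + (vq q a - m) + (vq q b - m) + (vq q c - m) + (vq q a' - m)).
  move=> a0 b0 c0 a'0 nb nc e.
  have nz1 : 2 * a * b * c * a' != 0 by rewrite !mulf_neq0.
  have nz2 : a ^+ 4 - (ea - eb) * (ea - ec) != 0.
    by apply: contraNneq nz1 => z; rewrite z expr0n in e; move/eqP: e; rewrite expf_eq0.
  have ev := sqv _ _ nz1 nz2 e; rewrite !vqM ?mulf_neq0 // in ev.
  have -> : vq q 2 + (vq q a - m) + (vq q b - m) + (vq q c - m) + (vq q a' - m) =
    vq q (a ^+ 4 - (ea - eb) * (ea - ec)) - 4 * m by rewrite -ev; ring.
  have -> : 4 * (vq q a - m) = vq q (a ^+ 4) - 4 * m by rewrite vqX //; ring.
  have -> : vq q (ea - eb) - 2 * m + (vq q (ea - ec) - 2 * m) =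
      vq q ((ea - eb) * (ea - ec)) - 4 * m by rewrite vqM ?subr_eq0 //; ring.
  by apply/ultra_shift/vq_ultraB => //; rewrite ?mulf_neq0 ?expf_neq0 ?subr_eq0.
have vd (a b : rat) : vq q (a - b) = vq q (b - a) by rewrite -vqN opprB.
split=> // j; case: (nz j) => ? ? ?; case: (nz (j + N)%N) => ? ? ?;
  case: (nz j.+1) => ? ? ?; case: (sq j) => s1 s2; case: (per j) => ? ? ?;
  case: (st j) => ? ? ?.
- by congr (_ - m); apply: sqv.
- by congr (_ - m); apply: sqv.
- by congr (_ - m); apply: sqv.
- exact: dif.
- exact: dif.
- by apply: dif => //; rewrite -s1.
- exact: step.
- rewrite (vd e1 e2) [vq q 2 + _ + _]addrAC; apply: step => //; first by rewrite eq_sym.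
  by rewrite -[X in (X * _ * _) ^+ 2]mulrAC.
- rewrite (vd e1 e3) (vd e2 e3).
  have perm (k x y z t : int) : k + x + y + z + t = k + z + x + y + t by ring.
  rewrite perm; apply: step => //; try by rewrite eq_sym.
  by have -> : 2 * r3 j * r1 j * r2 j = 2 * r1 j * r2 j * r3 j by ring.
Qed.

(** A 2-adic unit is a quotient of odd integers, and a sum of two odd squares is 2 modulo 4. *)
Lemma vq2_sqr_add1 (r : rat) : r != 0 -> vq 2 r = 0 -> vq 2 (r ^+ 2 + 1) = 1.
Proof.
move=> r0; pose a := numq r; pose b := denq r.
have a0 : a != 0 by rewrite numq_eq0.
have b0 : b != 0 by rewrite denq_eq0.
have co : coprime `|a| `|b| := coprime_num_den r.
rewrite /vq -/a -/b => e.
have eab : (logn 2 `|a| = logn 2 `|b|)%N by lia.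
have oab : odd `|a| && odd `|b|.
  have l t : t != 0 -> odd `|t| = (logn 2 `|t| == 0)%N.
    move=> t0; rewrite eqn0Ngt -[odd _]negbK -dvdn2; congr (~~ _).
    by rewrite logn_gt0 mem_primes /= absz_gt0 t0.
  rewrite !l // -eab andbb -l //; apply/negPn/negP => ea.
  have eb : ~~ odd `|b| by rewrite l // -eab -l.
  have : (2 %| gcdn `|a| `|b|)%N by rewrite dvdn_gcd !dvdn2 ea.
  by rewrite (eqP co).
have -> : r ^+ 2 + 1 = (a ^+ 2 + b ^+ 2)%:Q / (b ^+ 2)%:Q.
  have bq : b%:Q != 0 by rewrite intr_eq0.
  rewrite -{1}[r]divq_num_den -/a -/b !rmorphD !rmorphXn /=; field.
  exact: bq.
rewrite -/(vq 2 _) vq_frac ?expf_neq0 //; last by rewrite gt_eqF // ltr_wpDl ?sqr_ge0 // exprn_even_gt0.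
rewrite abszX lognX.
have /andP[oa ob] := oab.
have -> : logn 2 `|b| = 0%N by apply/eqP; rewrite -leqn0 leqNgt logn_gt0 mem_primes /= dvdn2 ob andbF.
have -> : `|(a ^+ 2 + b ^+ 2)%R|%N = (`|a| ^ 2 + `|b| ^ 2)%N.
  by apply/eqP; rewrite -eqz_nat gez0_abs ?addr_ge0 ?sqr_ge0 // PoszD -!abszX !gez0_abs ?sqr_ge0.
have [k ->] : exists k, (`|a| ^ 2 + `|b| ^ 2 = 2 * (2 * k + 1))%N.
  have [x ->] : exists x, `|a|%N = (2 * x + 1)%N by exists (`|a|%N./2); lia.
  have [y ->] : exists y, `|b|%N = (2 * y + 1)%N by exists (`|b|%N./2); lia.
  by exists (x ^ 2 + x + y ^ 2 + y)%N; ring.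
rewrite lognM // ?addn1 // logn_prime // (_ : logn 2 _ = 0%N) //.
by apply/eqP; rewrite -leqn0 leqNgt logn_gt0 mem_primes /= dvdn2 /= oddM.
Qed.

(** Here t, b, c are the valuations of s, s^2 - 1, s^2 + 1 at an odd prime, where the difference 2
    of the last two is a unit. In each case two of 2 s, s^2 - 1, s^2 + 1 have equal valuation and
    the third has at least that one. *)
Lemma abc_val_odd (t b c : int) :
  ultra (2 * t) 0 b -> ultra (2 * t) 0 c -> ultra c b 0 ->
  [\/ [/\ 0 < t, b = 0 & c = 0], [/\ t < 0, b = 2 * t & c = 2 * t],
      [/\ t = 0, c = 0 & 0 <= b] | [/\ t = 0, b = 0 & 0 <= c]].
Proof.
rewrite /ultra => hb hc hbc.
have [?|[?|[[? ?]|[? ?]]]] : 0 < t \/ t < 0 \/ (t = 0 /\ c = 0) \/ (t = 0 /\ b = 0).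
- lia.
- by apply: Or41; split; lia.
- by apply: Or42; split; lia.
- by apply: Or43; split; lia.
- by apply: Or44; split; lia.
Qed.

Lemma abc_val_two (t b c : int) :
  ultra (2 * t) 0 b -> ultra (2 * t) 0 c -> t != 0 ->
  (0 < t /\ b = 0 /\ c = 0) \/ (t < 0 /\ b = 2 * t /\ c = 2 * t).
Proof. by rewrite /ultra; lia. Qed.

(** For s a unit at 2, [p] and [m] are the valuations there of s + 1 and s - 1; the bound says that
    4 divides s^2 - 1. *)
Lemma odd_square_val (p m : int) : ultra 0 0 p -> ultra 0 0 m -> ultra p m 1 ->
  ultra 1 (p + m) 1 -> 2 <= p + m.
Proof. by rewrite /ultra; lia. Qed.

Section NoOrbit.
Variable s : rat.
Hypotheses (s0 : s != 0) (s1 : s != 1) (sN1 : s != -1).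
Variables (u v w : nat -> rat) (N : nat).
Hypothesis orb :
  doubling_orbit 0 ((2 * s) ^+ 2) (- (s ^+ 2 - 1) ^+ 2) u v w N.

Let A0 : 2 * s != 0. Proof. by rewrite mulf_neq0. Qed.
Let B0 : s ^+ 2 - 1 != 0.
Proof. by rewrite subr_eq0 sqrf_eq1 negb_or s1. Qed.
Let C0 : s ^+ 2 + 1 != 0.
Proof. by rewrite gt_eqF // ltr_wpDl ?sqr_ge0. Qed.

Lemma vq_two q : prime q -> vq q 2 = (q == 2%N).
Proof. by move=> pr; rewrite (vq_int pr (a := 2)) // logn_prime. Qed.

(** Let A, B, C be 2 s, s^2 - 1, s^2 + 1. At an odd prime the cases say which of them has the
    largest valuation. For A, the valuations of u and v agree; for B or C they agree, or one is 0
    and the other even. At 2 the close pair is again given by A, unless s is a unit there. *)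
Lemma orbit_ratio_even q : prime q -> exists k, vq q (u 0%N / v 0%N) = 2 * k.
Proof.
move=> pr.
have [u0 v0 w0] := do_neq0 orb 0.
rewrite vqM ?invr_eq0 // vqV //.
have orb13 := doubling_orbit132 orb; have orb23 := doubling_orbit231 orb.
have d12 : vq q (0 - (2 * s) ^+ 2) = 2 * vq q (2 * s) by rewrite sub0r vqN vqX.
have d13 : vq q (0 - - (s ^+ 2 - 1) ^+ 2) = 2 * vq q (s ^+ 2 - 1).
  by rewrite sub0r opprK vqX.
have d23 : vq q ((2 * s) ^+ 2 - - (s ^+ 2 - 1) ^+ 2) = 2 * vq q (s ^+ 2 + 1).
  by rewrite -vqX //; congr vq; ring.
have vswap x y : vq q (x - y) = vq q (y - x) by rewrite -vqN opprB.
have vB : ultra (2 * vq q s) 0 (vq q (s ^+ 2 - 1)).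
  by rewrite -vqX // -(vq1 pr); apply: vq_ultraB; rewrite ?expf_neq0 ?oner_neq0.
have vC : ultra (2 * vq q s) 0 (vq q (s ^+ 2 + 1)).
  by rewrite -vqX // -(vq1 pr); apply: vq_ultra; rewrite ?expf_neq0 ?oner_neq0.
have vBC : ultra (vq q (s ^+ 2 + 1)) (vq q (s ^+ 2 - 1)) (vq q 2).
  by apply: vq_ultraB => //; ring.
have vA : vq q (2 * s) = vq q 2 + vq q s by rewrite vqM.
have v2 := vq_two pr.
have [q2|q2] := eqVneq q 2%N; last first.
  rewrite (negPf q2) /= in v2; rewrite v2 add0r in vA; rewrite v2 in vBC.
  have c0 : 0 <= vq q 2 by rewrite v2.
  case: (abc_val_odd vB vC vBC) => -[eA eB eC].
  - have := orbit_val (h := vq q s) (m := 0) pr orb.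
    rewrite d12 d13 d23 vA eB eC mulr0 add0r => /(_ erefl erefl erefl) vo.
    have [[+ _]|[_ [k []]]] := val_orbit_odd c0 (ltW eA) vo v2 0%N; last move=> + ek.
      by clear; exists 0; lia.
    by move: ek; clear; exists 0; lia.
  - have := orbit_val (h := - vq q s) (m := 2 * vq q s) pr orb.
    rewrite d12 d13 d23 vA eB eC; move=> /(_ ltac:(ring) erefl erefl) vo.
    have h0 : 0 <= - vq q s by rewrite oppr_ge0 ltW.
    have [[+ _]|[_ [k []]]] := val_orbit_odd c0 h0 vo v2 0%N; last move=> + ek.
      by clear; exists 0; lia.
    by move: ek; clear; exists 0; lia.
  - have := orbit_val (h := vq q (s ^+ 2 - 1)) (m := 0) pr orb13.
    rewrite vswap in d23.
    rewrite d12 d13 d23 vA eA eB mulr0 add0r => /(_ erefl erefl erefl) vo.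
    have [[+ +]|[+ [k []]]] := val_orbit_odd c0 eC vo v2 0%N.
      by clear; exists 0; lia.
    by clear; exists k; lia.
  - have := orbit_val (h := vq q (s ^+ 2 + 1)) (m := 0) pr orb23.
    rewrite vswap in d12; rewrite vswap in d13.
    rewrite d12 d13 d23 vA eA eB mulr0 add0r => /(_ erefl erefl erefl) vo.
    have [[+ +]|[+ [k []]]] := val_orbit_odd c0 eC vo v2 0%N.
      by clear; exists 0; lia.
    by clear; exists (- k); lia.
subst q; rewrite /= in v2.
have c0 : 0 <= vq 2 2 by rewrite v2.
have [sz|snz] := eqVneq (vq 2 s) 0; last first.
  case: (abc_val_two vB vC snz) => -[eA [eB eC]].
  - have := orbit_val (h := 1 + vq 2 s) (m := 0) pr orb.
    rewrite d12 d13 d23 vA v2 eB eC mulr0 add0r => /(_ erefl erefl erefl) vo.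
    have h0 : 0 < 1 + vq 2 s by move: eA; clear; lia.
    have := val_orbit_two_good (c := 1) ler01 (ltW h0) vo erefl h0 0%N.
    by clear; exists 0; lia.
  - have := orbit_val (h := 1 - vq 2 s) (m := 2 * vq 2 s) pr orb.
    rewrite d12 d13 d23 vA v2 eB eC; move=> /(_ ltac:(ring) erefl erefl) vo.
    have h0 : 0 < 1 - vq 2 s by move: eA; clear; lia.
    have := val_orbit_two_good (c := 1) ler01 (ltW h0) vo erefl h0 0%N.
    by clear; exists 0; lia.
(* Now s is a unit at 2: A and C have valuation 1 and B at least 2, so v j / A is a unit for some j.
   Then (v j / A)^2 + 1 = (u j / A)^2 has valuation 1, yet it is a square. *)
exfalso.
have eC := vq2_sqr_add1 s0 sz.
have sp0 : s + 1 != 0 by rewrite addr_eq0.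
have sm0 : s - 1 != 0 by rewrite subr_eq0.
have eBsp : vq 2 (s ^+ 2 - 1) = vq 2 (s + 1) + vq 2 (s - 1).
  by rewrite -vqM //; congr vq; ring.
have eB : 2 <= vq 2 (s ^+ 2 - 1).
  rewrite eBsp; apply: odd_square_val.
  - by rewrite -{1}sz -(vq1 pr); apply: vq_ultra; rewrite // oner_neq0.
  - by rewrite -{1}sz -(vq1 pr); apply: vq_ultraB; rewrite // oner_neq0.
  - by rewrite -[X in ultra _ _ X]v2; apply: vq_ultraB => //; ring.
  - by move: vBC; rewrite eC v2 eBsp.
have := orbit_val (h := vq 2 (s ^+ 2 - 1) - 1) (m := 1) pr orb13.
rewrite vswap in d23.
rewrite d12 d13 d23 vA eC sz v2 addr0; move=> /(_ ltac:(ring) erefl erefl) vo.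
have h0 : 0 < vq 2 (s ^+ 2 - 1) - 1 by move: eB; clear; lia.
have [j vj] := val_orbit_two_bad (c := 1) ler01 (ltW h0) vo erefl h0.
have [uj vj0 _] := do_neq0 orb j.
have r0 : v j / (2 * s) != 0 by rewrite mulf_neq0 ?invr_eq0.
have := vq2_sqr_add1 r0; rewrite vqM ?invr_eq0 // vqV // vA sz v2 addr0.
move=> /(_ vj).
have -> : (v j / (2 * s)) ^+ 2 + 1 = (u j / (2 * s)) ^+ 2.
  have [+ _] := do_sqr orb j; rewrite addr0 => eu.
  by rewrite !expr_div_n eu; field.
rewrite vqX ?mulf_neq0 ?invr_eq0 //; clear; lia.
Qed.

Lemma no_doubling_orbit : False.
Proof.
have [u0 v0 _] := do_neq0 orb 0.
have uv0 : u 0%N / v 0%N != 0 by rewrite mulf_neq0 ?invr_eq0.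
have [r er] := even_vq_square uv0 orbit_ratio_even.
have r4 : (u 0%N / v 0%N) ^+ 2 = r ^+ 4 by case: er => ->; ring.
have : r ^+ 4 - 1 = (2 * s / v 0%N) ^+ 2.
  rewrite -r4 !expr_div_n; have [+ _] := do_sqr orb 0; rewrite addr0 => ->.
  by field.
by move/fermat_rat/eqP; apply/negP; rewrite mulf_neq0 ?invr_eq0.
Qed.

End NoOrbit.

(** * The group law *)

Local Open Scope classical_set_scope.
Local Open Scope ring_scope.
Local Arguments ec_add : simpl never.

Section GroupLaw.
Variables a2 a4 : rat.
Local Notation "P +' Q" := (ec_add a2 a4 P Q) (at level 50, left associativity).

Definition on_curve (P : option (rat * rat)) : Prop :=
  if P is Some (x, y) then y ^+ 2 = x ^+ 3 + a2 * x ^+ 2 + a4 * x else True.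

Hypothesis nonsing : forall x, x ^+ 3 + a2 * x ^+ 2 + a4 * x = 0 ->
  3 * x ^+ 2 + 2 * a2 * x + a4 != 0.

Lemma ec_add0 P : P +' None = P.
Proof. by case: P => [[]|]. Qed.

Lemma ec_0add P : None +' P = P.
Proof. by []. Qed.

Definition ec_opp (P : option (rat * rat)) : option (rat * rat) :=
  if P is Some (x, y) then Some (x, - y) else None.

(* Both equations hold for the chord (x1 <> x2) and for the tangent
   (P1 = P2, y1 <> 0), so chord and tangent need not be distinguished. *)
Definition slope (l : rat) (P Q : rat * rat) : Prop :=
  Q.2 - P.2 = l * (Q.1 - P.1) /\
  l * (P.2 + Q.2) =
    P.1 ^+ 2 + P.1 * Q.1 + Q.1 ^+ 2 + a2 * (P.1 + Q.1) + a4.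

Lemma slopeC l P Q : slope l P Q -> slope l Q P.
Proof.
by case=> h1 h2; split; [rewrite -opprB h1 | rewrite addrC h2]; ring.
Qed.

Definition add_slope (l : rat) (P Q : rat * rat) : rat * rat :=
  let x := l ^+ 2 - a2 - P.1 - Q.1 in (x, l * (P.1 - x) - P.2).

Lemma add_slopeC l P Q : slope l P Q -> add_slope l P Q = add_slope l Q P.
Proof.
case: P Q => [x1 y1] [x2 y2] [/= h1 _]; rewrite /add_slope /=.
have -> : y2 = y1 + l * (x2 - x1) by rewrite -h1; ring.
by congr pair; ring.
Qed.

Lemma slope_unique l l' P Q : Some P <> ec_opp (Some Q) ->
  slope l P Q -> slope l' P Q -> l = l'.
Proof.
case: P Q => [x1 y1] [x2 y2] /= nopp [/= h1 h2] [/= h1' h2'].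
have [ex|nex] := eqVneq x1 x2; last first.
  have nz : x2 - x1 != 0 by rewrite subr_eq0 eq_sym.
  by apply: (mulIf nz); rewrite -h1 -h1'.
have nz : y1 + y2 != 0.
  apply/negP => /eqP e; apply: nopp; congr (Some (_, _)) => //.
  by apply/eqP; rewrite -addr_eq0; apply/eqP.
by apply: (mulIf nz); rewrite h2 h2'.
Qed.

Lemma ec_add_exists P Q : on_curve (Some P) -> on_curve (Some Q) ->
  Some P <> ec_opp (Some Q) ->
  exists2 l, slope l P Q & Some P +' Some Q = Some (add_slope l P Q).
Proof.
case: P Q => [x1 y1] [x2 y2] /= c1 c2 nopp; rewrite /ec_add.
case: (eqVneq x1 x2) => [ex|nex] /=.
  subst x2.
  have ny : y1 != - y2 by apply/eqP => e; apply: nopp; rewrite e.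
  have ey : y1 = y2.
    have : (y1 - y2) * (y1 + y2) = 0 by rewrite -subr_sqr c1 c2 subrr.
    move/eqP; rewrite mulf_eq0 subr_eq0 addr_eq0 (negPf ny) orbF.
    by move/eqP.
  subst y2; rewrite (negPf ny).
  have y0 : 2 * y1 != 0.
    by move: ny; rewrite -addr_eq0 mulr_natl mulr2n.
  exists ((3 * x1 ^+ 2 + 2 * a2 * x1 + a4) / (2 * y1)); last by [].
  split => /=; first by ring.
  have y1n : y1 != 0 by apply: contraNneq y0 => ->; rewrite mulr0.
  by field.
exists ((y2 - y1) / (x2 - x1)); last by [].
have nz : x2 - x1 != 0 by rewrite subr_eq0 eq_sym.
split => /=; first by rewrite divfK.
apply: (mulIf nz); rewrite mulrAC divfK //.
have -> : (y2 - y1) * (y1 + y2) = y2 ^+ 2 - y1 ^+ 2 by ring.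
by rewrite c1 c2; ring.
Qed.

Lemma ec_addE l P Q : on_curve (Some P) -> on_curve (Some Q) ->
  Some P <> ec_opp (Some Q) -> slope l P Q ->
  Some P +' Some Q = Some (add_slope l P Q).
Proof.
move=> c1 c2 nopp sl; have [l' sl' ->] := ec_add_exists c1 c2 nopp.
by rewrite (slope_unique nopp sl sl').
Qed.

Lemma ec_addC P Q : on_curve P -> on_curve Q -> P +' Q = Q +' P.
Proof.
case: P Q => [P|] [Q|] // cP cQ; rewrite ?ec_add0 ?ec_0add //.
have [nopp|opp] := pselect (Some P <> ec_opp (Some Q)).
  have [l sl ->] := ec_add_exists cP cQ nopp.
  have nopp' : Some Q <> ec_opp (Some P).
    move=> e; apply: nopp; case: P Q e {cP cQ sl} => [x1 y1] [x2 y2] [-> ->].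
    by rewrite /= opprK.
  by rewrite (ec_addE cQ cP nopp' (slopeC sl)) add_slopeC.
move/contrapT: opp; case: P Q {cP cQ} => [x1 y1] [x2 y2] [-> ->].
by rewrite /= /ec_add opprK !eqxx.
Qed.

Lemma ec_add_opp P : P +' ec_opp P = None.
Proof. by case: P => [[x y]|] //=; rewrite /ec_add opprK !eqxx. Qed.

Lemma ec_oppK P : ec_opp (ec_opp P) = P.
Proof. by case: P => [[x y]|] //=; rewrite opprK. Qed.

Lemma on_curve_opp P : on_curve P -> on_curve (ec_opp P).
Proof. by case: P => [[x y]|] //=; rewrite sqrrN. Qed.

(** The slope equations are solved for y2 and [a4]; what remains is a polynomial identity modulo the
    equation of the curve at P. *)
Lemma on_add_slope l P Q : on_curve (Some P) -> slope l P Q ->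
  on_curve (Some (add_slope l P Q)).
Proof.
case: P Q => [x1 y1] [x2 y2] /= c1 [/= h1 h2].
have e2 : y2 = y1 + l * (x2 - x1) by rewrite -h1; ring.
have e4 : a4 = l * (y1 + y2) - (x1 ^+ 2 + x1 * x2 + x2 ^+ 2 + a2 * (x1 + x2)).
  by rewrite h2; ring.
set x := l ^+ 2 - a2 - x1 - x2.
have -> : (l * (x1 - x) - y1) ^+ 2 =
  y1 ^+ 2 + l ^+ 2 * (x1 - x) ^+ 2 - 2 * l * y1 * (x1 - x) by ring.
by rewrite c1 e4 e2 /x; ring.
Qed.

Lemma on_curve_add P Q : on_curve P -> on_curve Q -> on_curve (P +' Q).
Proof.
case: P Q => [P|] [Q|] // cP cQ; rewrite ?ec_add0 ?ec_0add //.
have [nopp|/contrapT ->] := pselect (Some P <> ec_opp (Some Q)).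
  have [l sl ->] := ec_add_exists cP cQ nopp; exact: on_add_slope.
by rewrite ec_addC //; [rewrite ec_add_opp | apply: on_curve_opp].
Qed.

Lemma ec_opp_add P Q : on_curve P -> on_curve Q ->
  ec_opp (P +' Q) = ec_opp P +' ec_opp Q.
Proof.
case: P Q => [P|] [Q|] // cP cQ; rewrite ?ec_add0 ?ec_0add //.
have [nopp|/contrapT ->] := pselect (Some P <> ec_opp (Some Q)).
  have [l [h1 h2] ->] := ec_add_exists cP cQ nopp.
  have nopp' : ec_opp (Some P) <> ec_opp (ec_opp (Some Q)).
    by move=> /(congr1 ec_opp); rewrite !ec_oppK.
  case: P Q cP cQ nopp nopp' h1 h2 => [x1 y1] [x2 y2] cP cQ _ nopp' /= h1 h2.
  rewrite (@ec_addE (- l) (x1, - y1) (x2, - y2)) //=; rewrite ?sqrrN //.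
    by rewrite /add_slope /= sqrrN; congr (Some (_, _)); ring.
  split => /=; last by rewrite -h2; ring.
  by rewrite mulNr -h1; ring.
by rewrite ec_oppK !(@ec_addC (ec_opp _)) ?ec_add_opp //; apply: on_curve_opp.
Qed.

(** The line through -P and P + Q has slope -l. Nonsingularity rules out P + Q = P, which would give
    y1 = 0 and make the derivative of the cubic vanish at x1. *)
Lemma ec_addKl P Q : on_curve P -> on_curve Q ->
  ec_opp P +' (P +' Q) = Q.
Proof.
case: P Q => [P|] [Q|] // cP cQ; last first.
  by rewrite ec_add0 ec_addC ?ec_add_opp //; apply: on_curve_opp.
have [nopp|/contrapT e] := pselect (Some P <> ec_opp (Some Q)); last first.
  by rewrite e ec_oppK (@ec_addC (ec_opp _)) ?ec_add_opp ?ec_add0 //; apply: on_curve_opp.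
have [l sl ->] := ec_add_exists cP cQ nopp.
case: P Q cP cQ nopp sl => [x1 y1] [x2 y2] cP cQ nopp sl.
have c3 := on_add_slope cP sl.
case: (sl) => /= h1 h2.
have nopp' : Some (x1, - y1) <> ec_opp (Some (add_slope l (x1, y1) (x2, y2))).
  rewrite /add_slope /=; set x := l ^+ 2 - _ - _ - _ => -[ex ey].
  have y0 : y1 = 0.
    have : 2 * y1 = 0.
      move: ey; rewrite -ex subrr mulr0 sub0r opprK => ey.
      by rewrite mulr_natl mulr2n -{1}[y1]opprK ey addNr.
    by move/eqP; rewrite mulf_eq0 pnatr_eq0 /= => /eqP.
  have /eqP : 3 * x1 ^+ 2 + 2 * a2 * x1 + a4 != 0.
    by apply: nonsing; rewrite -[LHS]cP y0 expr0n.
  apply.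
  have e2 : y2 = l * (x2 - x1) by rewrite -h1 y0 subr0.
  have ea2 : a2 = l ^+ 2 - 2 * x1 - x2.
    have -> : a2 = l ^+ 2 - x1 - x2 - x by rewrite /x; ring.
    by rewrite -ex; ring.
  have ea4 : a4 = l * y2 - (x1 ^+ 2 + x1 * x2 + x2 ^+ 2 + a2 * (x1 + x2)).
    by rewrite -[y2]add0r -y0 h2; ring.
  by rewrite ea4 e2 ea2; ring.
rewrite (@ec_addE (- l) (x1, - y1)) //; first last.
- rewrite /add_slope /=; split => /=; first by ring.
  have -> : a4 = l * (y1 + y2) - (x1 ^+ 2 + x1 * x2 + x2 ^+ 2 + a2 * (x1 + x2)).
    by rewrite h2; ring.
  have -> : y2 = y1 + l * (x2 - x1) by rewrite -h1; ring.
  by ring.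
- exact: (@on_curve_opp (Some (x1, y1))).
rewrite /add_slope /=; congr (Some (_, _)); first by ring.
have -> : y2 = y1 + l * (x2 - x1) by rewrite -h1; ring.
by ring.
Qed.

(** Equates the two expressions for [a4] given by the lines PQ and QR. For l != k this determines
    y2; for l = k it forces x3 to be x1 or the third abscissa on the line PQ. *)
Lemma slopes_middle l k P Q R : slope l P Q -> slope k Q R ->
  2 * (l - k) * Q.2 = (R.1 - Q.1) * (k ^+ 2 - a2 - P.1 - Q.1 - R.1) -
                      (P.1 - Q.1) * (l ^+ 2 - a2 - P.1 - Q.1 - R.1).
Proof.
case: P Q R => [x1 y1] [x2 y2] [x3 y3] [/= h1 h2] [/= h3 h4].
have e1 : y1 = y2 - l * (x2 - x1) by rewrite -h1; ring.
have e3 : y3 = y2 + k * (x3 - x2) by rewrite -h3; ring.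
have e4 : a4 = l * (y1 + y2) - (x1 ^+ 2 + x1 * x2 + x2 ^+ 2 + a2 * (x1 + x2)).
  by rewrite h2; ring.
have e4' : a4 = k * (y2 + y3) - (x2 ^+ 2 + x2 * x3 + x3 ^+ 2 + a2 * (x2 + x3)).
  by rewrite h4; ring.
by apply/eqP; rewrite -subr_eq0 -[X in _ == X](subrr a4) {1}e4 e4' e1 e3;
  apply/eqP; ring.
Qed.

(** With y2 taken from [slopes_middle], everything is rational in x1, x2, x3, l, k and [a2], and the
    slope equations become field identities. *)
Lemma slope_assoc l k P Q R : slope l P Q -> slope k Q R -> l != k ->
  slope ((P.1 - R.1) / (l - k) - l) (add_slope l P Q) R.
Proof.
move=> sl sk nlk; have nz : l - k != 0 by rewrite subr_eq0.
have := slopes_middle sl sk.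
case: P Q R sl sk => [x1 y1] [x2 y2] [x3 y3] [/= h1 h2] [/= h3 h4] e2.
have {}e2 : y2 = ((x3 - x2) * (k ^+ 2 - a2 - x1 - x2 - x3) -
                (x1 - x2) * (l ^+ 2 - a2 - x1 - x2 - x3)) / (2 * (l - k)).
  by rewrite -e2; field.
have e1 : y1 = y2 - l * (x2 - x1) by rewrite -h1; ring.
have e3 : y3 = y2 + k * (x3 - x2) by rewrite -h3; ring.
have e4 : a4 = l * (y1 + y2) - (x1 ^+ 2 + x1 * x2 + x2 ^+ 2 + a2 * (x1 + x2)).
  by rewrite h2; ring.
by split => /=; rewrite ?e4 e1 ?e3 e2; field.
Qed.

(** If one of the four sums is of opposite points, cancellation by [ec_addKl] suffices. Otherwise
    all sums are given by slopes, and the lines PQ and QR are compared. *)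
Lemma ec_addA P Q R : on_curve P -> on_curve Q -> on_curve R ->
  P +' (Q +' R) = P +' Q +' R.
Proof.
move=> cP cQ cR.
have [e|nPQ] := pselect (P = ec_opp Q).
  subst P; rewrite ec_addKl // (@ec_addC (ec_opp _)) ?ec_add_opp //.
have [e|nQR] := pselect (Q = ec_opp R).
  have cOR := on_curve_opp cR.
  have cPR := on_curve_add cOR cP.
  subst Q; rewrite (@ec_addC (ec_opp _) R) // ec_add_opp ec_add0 (@ec_addC P) //.
  by rewrite (@ec_addC _ R) // -[X in X +' _]ec_oppK ec_addKl.
have [e|nPQR] := pselect (P +' Q = ec_opp R).
  have cPQ := on_curve_add cP cQ.
  have eR : R = ec_opp P +' ec_opp Q by rewrite -ec_opp_add // e ec_oppK.
  have -> : P +' Q +' R = None by rewrite e ec_addC ?ec_add_opp //; apply: on_curve_opp.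
  rewrite eR (@ec_addC (ec_opp P)); try exact: on_curve_opp.
  by rewrite -{1}(ec_oppK Q) ec_addKl ?ec_add_opp //; apply: on_curve_opp.
have [e|nP_QR] := pselect (Q +' R = ec_opp P).
  have cQR := on_curve_add cQ cR.
  have eP : P = ec_opp R +' ec_opp Q.
    by rewrite -(ec_oppK P) -e ec_opp_add // ec_addC //; apply: on_curve_opp.
  have -> : P +' (Q +' R) = None by rewrite e ec_add_opp.
  have cO := on_curve_opp.
  rewrite eP (@ec_addC (ec_opp R)) ?(@ec_addC (_ +' _) Q); auto; last first.
    by apply: on_curve_add; auto.
  rewrite -{1}(ec_oppK Q) ec_addKl; auto.
  by rewrite ec_addC ?ec_add_opp; auto.
case: P Q R cP cQ cR nPQ nQR nPQR nP_QR => [P|] [Q|] [R|] // cP cQ cR;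
  rewrite ?ec_add0 ?ec_0add //.
move=> nPQ nQR nPQR nP_QR.
have [l sl el] := ec_add_exists cP cQ nPQ.
have [k sk ek] := ec_add_exists cQ cR nQR.
rewrite el in nPQR; rewrite ek in nP_QR; rewrite el ek.
have cPQ := on_add_slope cP sl; have cQR := on_add_slope cQ sk.
have [elk|nlk] := eqVneq l k; last first.
  have s1 := slope_assoc sl sk nlk.
  have s2 := slope_assoc (slopeC sk) (slopeC sl) (_ : k != l).
  rewrite eq_sym in s2; move/(_ nlk) : s2 => s2.
  rewrite -add_slopeC // in s2.
  have nP_QR' : Some P <> ec_opp (Some (add_slope k Q R)).
    by move=> e; apply: nP_QR; rewrite e ec_oppK.
  rewrite (ec_addE cPQ cR nPQR s1) (ec_addE cP cQR nP_QR' (slopeC s2)).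
  have := slopes_middle sl sk.
  case: P Q R sl sk {cP cQ cR nPQ nQR nPQR nP_QR nP_QR' el ek cPQ cQR s1 s2}
     => [x1 y1] [x2 y2] [x3 y3] [/= h1 h2] [/= h3 h4] e2.
  have nz : l - k != 0 by rewrite subr_eq0.
  have nz' : k - l != 0 by rewrite subr_eq0 eq_sym.
  have {}e2 : y2 = ((x3 - x2) * (k ^+ 2 - a2 - x1 - x2 - x3) -
                  (x1 - x2) * (l ^+ 2 - a2 - x1 - x2 - x3)) / (2 * (l - k)).
    by rewrite -e2; field.
  have -> : y1 = y2 - l * (x2 - x1) by rewrite -h1; ring.
  by rewrite /add_slope /= e2; congr (Some (_, _)); field; rewrite nz nz'.
subst k.
(* For equal slopes, either P = R and commutativity suffices, or R is the third point on the line
   PQ, so that P + Q = -R. *)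
have [exPR|nxPR] := eqVneq P.1 R.1.
  have ePR : P = R.
    case: P Q R sl sk exPR {cP cQ cR nPQ nQR nPQR nP_QR el ek cPQ cQR}
     => [x1 y1] [x2 y2] [x3 y3] [/= h1 h2] [/= h3 h4] ex; congr pair => //.
    have -> : y1 = y2 - l * (x2 - x1) by rewrite -h1; ring.
    by rewrite -[y3](subrK y2) h3 ex; ring.
  subst R; rewrite add_slopeC ?(ec_addC cP) //.
exfalso; apply: nPQR.
have := slopes_middle sl sk.
case: P Q R sl sk nxPR {cP cQ cR nPQ nQR nP_QR el ek cPQ cQR}
     => [x1 y1] [x2 y2] [x3 y3] [/= h1 h2] [/= h3 h4] /= nx e2.
have nz : x3 - x1 != 0 by rewrite subr_eq0 eq_sym.
have ex : l ^+ 2 - a2 - x1 - x2 = x3.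
  apply/eqP; rewrite -subr_eq0; apply/eqP; apply: (mulfI nz).
  by rewrite mulr0 -(mul0r y2) -(mulr0 2) -(subrr l) e2; ring.
rewrite /add_slope /= ex; congr (Some (_, _)).
have -> : y3 = y2 + l * (x3 - x2) by rewrite -h3; ring.
have -> : y2 = y1 + l * (x2 - x1) by rewrite -h1; ring.
ring.
Qed.
Lemma on_curve_mul n P : on_curve P -> on_curve (ec_mul a2 a4 n P).
Proof. by move=> cP; elim: n => //= n IHn; apply: on_curve_add. Qed.

Lemma ec_mulS n P : ec_mul a2 a4 n.+1 P = P +' ec_mul a2 a4 n P.
Proof. by []. Qed.

Lemma ec_mulD m n P : on_curve P ->
  ec_mul a2 a4 (m + n) P = ec_mul a2 a4 m P +' ec_mul a2 a4 n P.
Proof.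
move=> cP; elim: m => [|m IHm]; first by rewrite ec_0add.
by rewrite addSn !ec_mulS IHm ec_addA //; apply: on_curve_mul.
Qed.

Lemma ec_mul_modn n m P : on_curve P -> ec_mul a2 a4 n P = None ->
  ec_mul a2 a4 m P = ec_mul a2 a4 (m %% n) P.
Proof.
move=> cP nP; rewrite {1}(divn_eq m n) ec_mulD //.
suff -> : ec_mul a2 a4 (m %/ n * n) P = None by rewrite ec_0add.
by elim: (m %/ n)%N => //= d IHd; rewrite mulSn ec_mulD // nP IHd.
Qed.

Lemma ec_mul_2expS j P : on_curve P -> ec_mul a2 a4 (2 ^ j.+1) P =
  ec_mul a2 a4 (2 ^ j) P +' ec_mul a2 a4 (2 ^ j) P.
Proof. by move=> cP; rewrite expnS mul2n -addnn ec_mulD. Qed.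

(** With n = 2^a n' and n' odd, 2^(a + j) modulo n depends only on 2^j modulo n', which has period
    totient n' by Euler. *)
Lemma torsion_doubling P : on_curve P -> ec_torsion a2 a4 P ->
  (exists k, ec_mul a2 a4 (2 ^ k) P = None) \/
  exists k N, [/\ (0 < N)%N, forall j, ec_mul a2 a4 (2 ^ j) P <> None &
    forall j, ec_mul a2 a4 (2 ^ (k + j + N)) P = ec_mul a2 a4 (2 ^ (k + j)) P].
Proof.
move=> cP [n n0 nP].
have [|/forallNP none] := pselect (exists k, ec_mul a2 a4 (2 ^ k) P = None).
  by left.
right; exists (logn 2 n), (totient (n`_2^')%N); split=> [|j|j].
- by rewrite totient_gt0 part_gt0.
- exact: none.
rewrite (ec_mul_modn _ cP nP) [RHS](ec_mul_modn _ cP nP); congr (ec_mul _ _ _ P).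
have red a : (2 ^ (logn 2 n + a) %% n = 2 ^ logn 2 n * (2 ^ a %% n`_2^'))%N.
  by rewrite -{2}(partnC 2%N n0) p_part expnD -muln_modr.
rewrite -addnA !red; congr (_ * _)%N.
rewrite expnD -modnMmr Euler_exp_totient ?modnMmr ?muln1 //.
by rewrite coprime_sym (p'nat_coprime (part_pnat _ _)) // pnat_id.
Qed.

End GroupLaw.

(** * Torsion points of E_{1,s} *)

Section Torsion.
Variable s : rat.
Hypotheses (s0 : s != 0) (s1 : s != 1) (sN1 : s != -1).
Let A := 2 * s.
Let B := s ^+ 2 - 1.
Let C := s ^+ 2 + 1.

Let A0 : A != 0. Proof. by rewrite mulf_neq0. Qed.
Let B0 : B != 0.
Proof. by rewrite subr_eq0 sqrf_eq1 negb_or s1. Qed.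
Let C0 : C != 0.
Proof. by rewrite gt_eqF // ltr_wpDl ?sqr_ge0. Qed.
Let ABC : A ^+ 2 + B ^+ 2 = C ^+ 2. Proof. by rewrite /A /B /C; ring. Qed.

Local Notation a2 := (E1_a2 s).
Local Notation a4 := (E1_a4 s).
Local Notation onE := (on_curve a2 a4).

Lemma on_E1 x y : onE (Some (x, y)) <-> y ^+ 2 = x * (x - A ^+ 2) * (x + B ^+ 2).
Proof.
rewrite /= /E1_a2 /E1_a4 -/A -/B.
suff -> : x ^+ 3 + (B ^+ 2 - A ^+ 2) * x ^+ 2 + - (A ^+ 2 * B ^+ 2) * x =
  x * (x - A ^+ 2) * (x + B ^+ 2) by [].
by ring.
Qed.

Lemma E1_roots x : x * (x - A ^+ 2) * (x + B ^+ 2) = 0 ->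
  [\/ x = 0, x = A ^+ 2 | x = - B ^+ 2].
Proof.
move/eqP; rewrite !mulf_eq0 subr_eq0 addr_eq0 => /orP[/orP[]|] /eqP ->.
- exact: Or31.
- exact: Or32.
- exact: Or33.
Qed.

Lemma E1_nonsing x : x ^+ 3 + a2 * x ^+ 2 + a4 * x = 0 ->
  3 * x ^+ 2 + 2 * a2 * x + a4 != 0.
Proof.
move=> e; have /E1_roots : x * (x - A ^+ 2) * (x + B ^+ 2) = 0.
  by rewrite -e /E1_a2 /E1_a4 -/A -/B; ring.
rewrite /E1_a2 /E1_a4 -/A -/B => -[] ->.
- suff -> : 3 * 0 ^+ 2 + 2 * (B ^+ 2 - A ^+ 2) * 0 + - (A ^+ 2 * B ^+ 2) =
      - (A * B) ^+ 2 :> rat by rewrite oppr_eq0 expf_neq0 ?mulf_neq0.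
  by ring.
- suff -> : 3 * (A ^+ 2) ^+ 2 + 2 * (B ^+ 2 - A ^+ 2) * A ^+ 2 + - (A ^+ 2 * B ^+ 2) =
      (A * C) ^+ 2 :> rat by rewrite expf_neq0 ?mulf_neq0.
  by rewrite [RHS]exprMn -ABC; ring.
- suff -> : 3 * (- B ^+ 2) ^+ 2 + 2 * (B ^+ 2 - A ^+ 2) * (- B ^+ 2) + - (A ^+ 2 * B ^+ 2) =
      (B * C) ^+ 2 :> rat by rewrite expf_neq0 ?mulf_neq0.
  by rewrite [RHS]exprMn -ABC; ring.
Qed.

Lemma ec_dbl_eq0 x y : (ec_add a2 a4 (Some (x, y)) (Some (x, y)) == None) = (y == 0).
Proof.
have -> : (y == 0) = (y == - y).
  by rewrite -addr_eq0 -mulr2n -mulr_natl mulf_eq0.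
by rewrite /ec_add eqxx /=; case: ifP.
Qed.

(** On y^2 = (x - e1)(x - e2)(x - e3), x(2P) - ei is the square of ((x - ei)^2 - (ei - ej)(ei - ek))
    / (2 y); here the ei are 0, A^2, -B^2. *)
Lemma ec_dblE x y : onE (Some (x, y)) -> y != 0 ->
  exists x' y', [/\ ec_add a2 a4 (Some (x, y)) (Some (x, y)) = Some (x', y'),
    x' = ((x ^+ 2 + A ^+ 2 * B ^+ 2) / (2 * y)) ^+ 2,
    x' - A ^+ 2 = (((x - A ^+ 2) ^+ 2 - A ^+ 2 * C ^+ 2) / (2 * y)) ^+ 2 &
    x' + B ^+ 2 = (((x + B ^+ 2) ^+ 2 - B ^+ 2 * C ^+ 2) / (2 * y)) ^+ 2].
Proof.
move=> cP y0; have := ec_dbl_eq0 x y; rewrite (negPf y0) /ec_add eqxx /=.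
have [//|ny _] := eqVneq y (- y).
do 2 eexists; split; first by [].
all: rewrite -?ABC; apply: (mulIf (_ : (2 * y) ^+ 2 != 0)); rewrite ?expf_neq0 ?mulf_neq0 //.
all: have sqK (t u : rat) : u != 0 -> (t / u) ^+ 2 * u ^+ 2 = t ^+ 2
  by move=> u0; rewrite -exprMn divfK.
all: rewrite sqK ?mulf_neq0 //.
all: have yy : y ^+ 2 = x * (x - A ^+ 2) * (x + B ^+ 2) by apply/on_E1.
all: have eD (D c : rat) : ((D / (2 * y)) ^+ 2 + c) * (2 * y) ^+ 2 = D ^+ 2 + 4 * c * y ^+ 2
  by field.
all: rewrite -?addrA eD yy /E1_a2 /E1_a4 -/A -/B; ring.
Qed.

Definition special (P : option (rat * rat)) : Prop :=
  if P is Some (x, y) then [\/ y = 0, x = A ^+ 2 + A * C | x = A ^+ 2 - A * C]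
  else True.

Lemma square_quot (x y z : rat) : x != 0 -> x ^+ 2 * y = z ^+ 2 -> y = (z / x) ^+ 2.
Proof. by move=> x0 e; rewrite expr_div_n -e mulrAC divff ?mul1r // expf_neq0. Qed.

(* Otherwise n^4 - m^4 = (1 - m^4/4)^2. *)
Lemma no_order8 (m n : rat) : m ^+ 4 = A ^+ 2 -> n ^+ 2 <> C.
Proof.
move=> em en.
have m0 : m != 0 by apply: contraNneq A0 => m0; rewrite -sqrf_eq0 -em m0 expr0n.
have es : s ^+ 2 = m ^+ 4 / 4 by rewrite em /A; field.
have : (n / m) ^+ 4 - 1 = ((1 - m ^+ 4 / 4) / m ^+ 2) ^+ 2.
  have -> : (n / m) ^+ 4 = (n ^+ 2) ^+ 2 / m ^+ 4 by rewrite expr_div_n -exprM.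
  by rewrite en /C es; field.
move/fermat_rat/eqP; rewrite mulf_eq0 invr_eq0 expf_eq0 (negPf m0) orbF.
by rewrite -es subr_eq0 eq_sym sqrf_eq1 (negPf s1) (negPf sN1).
Qed.

(** For a double, x', x' - A^2 and x' + B^2 are squares. This excludes (0, 0) and (-B^2, 0); the
    halves of (A^2, 0) have x = A^2 +- A C, and halving those is left to [no_order8]. *)
Lemma special_half P : onE P -> special (ec_add a2 a4 P P) -> special P.
Proof.
case: P => [[x y]|//] cP; have [y0|ny0] := eqVneq y 0; first by move=> _; apply: Or31.
have [x' [y' [e ex ea eb]]] := ec_dblE cP ny0.
have /on_E1 c' : onE (Some (x', y')) by rewrite -e; apply: on_curve_add.
rewrite e => -[y'0|ex'|ex'].
- rewrite y'0 expr0n /= in c'; case: (E1_roots (esym c')) => ex'.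
  + exfalso; have := sqr_ge0 (((x - A ^+ 2) ^+ 2 - A ^+ 2 * C ^+ 2) / (2 * y)).
    by rewrite -ea ex' sub0r oppr_ge0 le_eqVlt sqrf_eq0 (negPf A0) ltNge sqr_ge0.
  + move: ea; rewrite ex' subrr => /esym/eqP.
    rewrite expf_eq0 mulf_eq0 invr_eq0 mulf_eq0 (negPf ny0) orbF pnatr_eq0 orbF /=.
    rewrite -exprMn subr_eq0 eqf_sqr => /orP[] /eqP h; [apply: Or32 | apply: Or33].
      by rewrite -h addrC subrK.
    by rewrite -h addrC subrK.
  + exfalso; have := sqr_ge0 ((x ^+ 2 + A ^+ 2 * B ^+ 2) / (2 * y)).
    by rewrite -ex ex' oppr_ge0 le_eqVlt sqrf_eq0 (negPf B0) ltNge sqr_ge0.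
- exfalso; set r := (_ / _) in ex; set t := (_ / _) in ea.
  have sp0 : s + 1 != 0 by rewrite addr_eq0.
  (* A^2 + A C = A (s + 1)^2, so A is a square. *)
  have e1 : A = (r / (s + 1)) ^+ 2.
    by apply: square_quot; rewrite // -ex ex' /A /C; ring.
  have e2 : C = (t / (r / (s + 1))) ^+ 2.
    apply: square_quot; first by rewrite -sqrf_eq0 -e1.
    by rewrite -e1 -ea ex'; ring.
  by apply: (@no_order8 (r / (s + 1))); [rewrite {1}e1; ring | exact: esym e2].
- exfalso; set r := (_ / _) in ex; set t := (_ / _) in ea.
  have sm0 : s - 1 != 0 by rewrite subr_eq0.
  (* A^2 - A C = -A (s - 1)^2, so -A is a square. *)
  have e1 : - A = (r / (s - 1)) ^+ 2.
    by apply: square_quot; rewrite // -ex ex' /A /C; ring.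
  have e2 : C = (t / (r / (s - 1))) ^+ 2.
    apply: square_quot; first by rewrite -sqrf_eq0 -e1 oppr_eq0.
    by rewrite -e1 -ea ex'; ring.
  apply: (@no_order8 (r / (s - 1))); last exact: esym e2.
  by rewrite -[A ^+ 2]sqrrN {1}e1; ring.
Qed.

Lemma torsion_special P : onE P -> ec_torsion a2 a4 P -> special P.
Proof.
move=> cP tP; have onD := fun n => on_curve_mul n cP.
have [[k ek]|[k [N [N0 nD per]]]] := torsion_doubling E1_nonsing cP tP.
  have : special (ec_mul a2 a4 (2 ^ 0) P).
    (* Descent from 2^k P = O to P, one halving at a time. *)
    suff H i : (i <= k)%N -> special (ec_mul a2 a4 (2 ^ (k - i)) P).
      by have := H k (leqnn k); rewrite subnn.
    elim: i => [|i IHi] lik; first by rewrite subn0 ek.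
    apply: special_half; first exact: onD.
    rewrite -ec_mul_2expS; [|exact: E1_nonsing|exact: cP].
    by rewrite -subSn // subSS; apply/IHi/ltnW.
  by rewrite expn0 ec_mulS /= ec_add0.
exfalso.
pose D j := ec_mul a2 a4 (2 ^ (k + j)) P.
pose X j := (odflt (0, 0) (D j)).1; pose Y j := (odflt (0, 0) (D j)).2.
have DE j : D j = Some (X j, Y j).
  by rewrite /X /Y; have := nD (k + j)%N; rewrite -/(D j); case: (D j) => [[]|].
have DS j : D j.+1 = ec_add a2 a4 (D j) (D j).
  by rewrite /D addnS ec_mul_2expS //; exact: E1_nonsing.
have onXY j : onE (Some (X j, Y j)) by rewrite -DE; apply: onD.
have Y0 j : Y j != 0.
  by rewrite -(ec_dbl_eq0 (X j)) -DE -DS; apply/eqP; apply: nD.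
have perX j : X (j + N)%N = X j by rewrite /X /D addnA per.
(* These are the roots for the point D j.+1, not D j. *)
pose u j := (X j ^+ 2 + A ^+ 2 * B ^+ 2) / (2 * Y j).
pose v j := ((X j - A ^+ 2) ^+ 2 - A ^+ 2 * C ^+ 2) / (2 * Y j).
pose w j := ((X j + B ^+ 2) ^+ 2 - B ^+ 2 * C ^+ 2) / (2 * Y j).
have uvw j : [/\ X j.+1 = u j ^+ 2, X j.+1 - A ^+ 2 = v j ^+ 2 &
    X j.+1 + B ^+ 2 = w j ^+ 2].
  have [x' [y' []]] := ec_dblE (onXY j) (Y0 j).
  by rewrite -DE -DS DE => -[<- _].
(* The product of the roots is the ordinate only up to sign, hence the squared step equations in
   [doubling_orbit]. *)
have YE j : (u j * v j * w j) ^+ 2 = Y j.+1 ^+ 2.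
  have /on_E1 -> := onXY j.+1; have [eu ev ew] := uvw j.
  by rewrite ev ew eu; ring.
have nz j : [/\ u j != 0, v j != 0 & w j != 0].
  have : (u j * v j * w j) ^+ 2 != 0 by rewrite YE expf_neq0.
  by rewrite sqrf_eq0 !mulf_eq0 !negb_or -andbA => /and3P.
apply: (@no_doubling_orbit s s0 s1 sN1 u v w N); rewrite -/A -/B.
split=> // [|j|j|j].
- split.
  + by rewrite eq_sym expf_neq0.
  + by rewrite eq_sym oppr_eq0 expf_neq0.
  + by rewrite -addr_eq0 ABC expf_neq0.
- have [<- <- <-] := uvw j; have [<- <- <-] := uvw (j + N)%N.
  by rewrite -addSn perX.
- by have [<- <- <-] := uvw j; split; ring.
- have step (r n : rat) : (2 * u j * v j * w j * (n / (2 * Y j.+1))) ^+ 2 = n ^+ 2.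
    have -> : (2 * u j * v j * w j * (n / (2 * Y j.+1))) ^+ 2 =
       (u j * v j * w j) ^+ 2 * n ^+ 2 / Y j.+1 ^+ 2 by field; apply: Y0.
    by rewrite YE; field; apply: Y0.
  have [eu ev ew] := uvw j.
  have -> : u j ^+ 4 - (0 - A ^+ 2) * (0 - - B ^+ 2) = X j.+1 ^+ 2 + A ^+ 2 * B ^+ 2.
    by rewrite eu; ring.
  have -> : v j ^+ 4 - (A ^+ 2 - 0) * (A ^+ 2 - - B ^+ 2) =
      (X j.+1 - A ^+ 2) ^+ 2 - A ^+ 2 * C ^+ 2 by rewrite ev -ABC; ring.
  have -> : w j ^+ 4 - (- B ^+ 2 - 0) * (- B ^+ 2 - A ^+ 2) =
      (X j.+1 + B ^+ 2) ^+ 2 - B ^+ 2 * C ^+ 2 by rewrite ew -ABC; ring.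
  by split; apply: step.
Qed.

Lemma special_torsion P : onE P -> special P -> ec_torsion a2 a4 P.
Proof.
case: P => [[x y]|] cP; last by exists 1%N.
have [->|y0] := eqVneq y 0.
  move=> _; exists 2%N => //; rewrite !ec_mulS /= ec_add0; apply/eqP.
  by rewrite ec_dbl_eq0.
case=> [|ex|ex]; first by move/eqP: y0.
all: have [x' [y' [e _ ea _]]] := ec_dblE cP y0.
all: have /on_E1 c' : onE (Some (x', y')) by rewrite -e; apply: on_curve_add.
all: have z : (x - A ^+ 2) ^+ 2 - A ^+ 2 * C ^+ 2 = 0 by rewrite ex; ring.
all: move: ea; rewrite z mul0r expr0n /= => ea; rewrite ea mulr0 mul0r in c'.
all: move/eqP: c'; rewrite sqrf_eq0 => c'.
all: exists (2 ^ 2)%N => //; apply/eqP; rewrite !ec_mul_2expS //; try exact: E1_nonsing.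
all: by rewrite expn0 ec_mulS /= ec_add0 e ec_dbl_eq0.
Qed.

End Torsion.

(** * The maps sigma, tau and F *)

(** For x = t this is gamma - (t^2 - 1)^2. Up to factors in s and a common denominator, the four
    linear forms are alpha, alpha - (2 s)^2, alpha + (s^2 - 1)^2 and 1, by [st_mul1], [st_mulN1],
    [st_add] and [st_sub]. *)
Lemma gammaB (s x : rat) : s != 0 ->
  (x ^+ 2 * (s - 1 / s) ^+ 2) - (x ^+ 2 - 1) ^+ 2 =
  (1 + x * s) * (x * s - 1) * (s + x) * (s - x) / s ^+ 2.
Proof. by move=> s0; field. Qed.

(** The torsion condition of [setA] made explicit: with A = 2 s and C = s^2 + 1, the two excluded
    values of [alpha] are A^2 + A C and A^2 - A C. *)
Definition admissible (s alpha beta : rat) : Prop :=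
  [/\ s != 0, s ^+ 2 != 1, beta != 0, E1_eq s alpha beta &
      alpha != 2 * s * (s + 1) ^+ 2 /\ alpha != - 2 * s * (s - 1) ^+ 2].

Lemma setAP (s alpha : rat) :
  setA (s, alpha) <-> exists beta, admissible s alpha beta.
Proof.
have spE beta : special s (Some (alpha, beta)) <->
    [\/ beta = 0, alpha = 2 * s * (s + 1) ^+ 2 | alpha = - 2 * s * (s - 1) ^+ 2].
  rewrite /special.
  have -> : (2 * s) ^+ 2 + 2 * s * (s ^+ 2 + 1) = 2 * s * (s + 1) ^+ 2 by ring.
  by have -> : (2 * s) ^+ 2 - 2 * s * (s ^+ 2 + 1) = - 2 * s * (s - 1) ^+ 2 by ring.
have onE beta : E1_eq s alpha beta ->
    on_curve (E1_a2 s) (E1_a4 s) (Some (alpha, beta)).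
  by move/E1_weierstrass.
split=> [[s0 a0 s1 sN1 [beta e nt]]|[beta [s0 s2 b0 e [n1 n2]]]].
  exists beta; have nsp : ~ special s (Some (alpha, beta)).
    by move=> sp; apply: nt; apply: special_torsion => //; apply: onE.
  split=> //; first by rewrite sqrf_eq1 negb_or s1.
    by apply/eqP => h; apply: nsp; apply/spE; apply: Or31.
  by split; apply/eqP => h; apply: nsp; apply/spE; [apply: Or32 | apply: Or33].
have [s1 sN1] : s != 1 /\ s != -1.
  by apply/andP; rewrite -negb_or -sqrf_eq1.
split=> //.
  by apply: contraNneq b0 => a0; rewrite -sqrf_eq0 -e a0 !mul0r.
exists beta => // /torsion_special sp; have /spE := sp s0 s1 sN1 (onE _ e).
by case=> /eqP; apply/negP.
Qed.

Section Admissible.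
Variables s alpha beta : rat.
Hypothesis adm : admissible s alpha beta.

Let s0 : s != 0. Proof. by case: adm. Qed.
Let beta0 : beta != 0. Proof. by case: adm. Qed.
Let eqE : E1_eq s alpha beta. Proof. by case: adm. Qed.
Let B0 : s ^+ 2 - 1 != 0. Proof. by case: adm => _; rewrite subr_eq0. Qed.
Let C0 : s ^+ 2 + 1 != 0. Proof. by rewrite gt_eqF // ltr_wpDl ?sqr_ge0. Qed.

Lemma admissible_factors : [/\ alpha != 0, alpha - (2 * s) ^+ 2 != 0 & alpha + (s ^+ 2 - 1) ^+ 2 != 0].
Proof.
have : beta ^+ 2 != 0 by rewrite expf_neq0.
by rewrite -eqE !mulf_eq0 !negb_or -andbA => /and3P.
Qed.

Let not_neg_square (x : rat) : beta ^+ 2 <> - x ^+ 2.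
Proof.
move/eqP; rewrite -addr_eq0 paddr_eq0 ?sqr_ge0 // sqrf_eq0 => /andP[+ _].
by apply/negP.
Qed.

(** At the zero of this denominator of t the cubic of E_{1,s} is minus a square, while [beta] is
    nonzero. [admissible_num] rests on the same argument. *)
Lemma admissible_den : alpha + 2 * s ^+ 2 * (s ^+ 2 - 1) != 0.
Proof.
rewrite addr_eq0; apply/eqP => e.
apply: (@not_neg_square (2 * s ^+ 2 * (s ^+ 2 - 1) * (s ^+ 2 + 1))).
by rewrite -eqE e; ring.
Qed.

Lemma admissible_num : alpha - 2 * (s ^+ 2 - 1) != 0.
Proof.
rewrite subr_eq0; apply/eqP => e.
apply: (@not_neg_square (2 * (s ^+ 2 - 1) * (s ^+ 2 + 1))).
by rewrite -eqE e; ring.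
Qed.

Let D0 := admissible_den.

Let pm0 : (s + 1) ^+ 2 != 0 /\ (s - 1) ^+ 2 != 0.
Proof.
by apply/andP; rewrite -negb_or -mulf_eq0 -exprMn expf_neq0 // mulrC -subr_sqr_1.
Qed.

(** On abscissae sigma is translation by the point (-(s^2 - 1)^2, 0) of order 2, and E_{1,-s} =
    E_{1,s}; the witness is the translated ordinate up to sign. *)
Lemma admissible_sigma : exists beta',
  admissible (sigma_formula (s, alpha)).1 (sigma_formula (s, alpha)).2 beta'.
Proof.
have [a0 _ b0] := admissible_factors; have [sp0 sm0] := pm0.
exists ((s ^+ 2 - 1) ^+ 2 * (s ^+ 2 + 1) ^+ 2 * beta / (alpha + (s ^+ 2 - 1) ^+ 2) ^+ 2).
case: adm => _ B1 _ _ [n1 n2]; rewrite /sigma_formula /=.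
split; rewrite ?oppr_eq0 ?sqrrN //.
- by rewrite !mulf_neq0 ?invr_eq0 ?expf_neq0.
- rewrite /E1_eq; have -> : ((s ^+ 2 - 1) ^+ 2 * (s ^+ 2 + 1) ^+ 2 * beta / (alpha + (s ^+ 2 - 1) ^+ 2) ^+ 2) ^+ 2
    = ((s ^+ 2 - 1) ^+ 2 * (s ^+ 2 + 1) ^+ 2 / (alpha + (s ^+ 2 - 1) ^+ 2) ^+ 2) ^+ 2 * beta ^+ 2.
    by field.
  by rewrite -eqE; field.
(* The translation permutes the excluded points of order 4; each identity writes the difference for
   [alpha] as a multiple of one for its image. *)
split; [apply: contraNneq n1 => e | apply: contraNneq n2 => e].
- rewrite -subr_eq0.
  have -> : alpha - 2 * s * (s + 1) ^+ 2 = - (alpha + (s ^+ 2 - 1) ^+ 2) *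
    (- (s ^+ 2 - 1) ^+ 2 * ((alpha - (2 * s) ^+ 2) / (alpha + (s ^+ 2 - 1) ^+ 2)) -
      2 * - s * (- s + 1) ^+ 2) / ((s - 1) ^+ 2 * (s ^+ 2 + 1)).
    by field; move: sm0; rewrite expf_eq0 /= b0 C0 => ->.
  by rewrite e subrr mulr0 mul0r.
- rewrite -subr_eq0.
  have -> : alpha - - 2 * s * (s - 1) ^+ 2 = - (alpha + (s ^+ 2 - 1) ^+ 2) *
    (- (s ^+ 2 - 1) ^+ 2 * ((alpha - (2 * s) ^+ 2) / (alpha + (s ^+ 2 - 1) ^+ 2)) -
      - 2 * - s * (- s - 1) ^+ 2) / ((s + 1) ^+ 2 * (s ^+ 2 + 1)).
    by field; move: sp0; rewrite expf_eq0 /= b0 C0 => ->.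
  by rewrite e subrr mulr0 mul0r.
Qed.

(** Translation by (0, 0), then the isomorphism (x, y) -> (x / s^4, y / s^6) from E_{1,s} to
    E_{1,1/s} = E_{1,-1/s}. *)
Lemma admissible_tau : exists beta',
  admissible (tau_formula (s, alpha)).1 (tau_formula (s, alpha)).2 beta'.
Proof.
have [a0 _ b0] := admissible_factors; have [sp0 sm0] := pm0.
exists ((2 * s) ^+ 2 * (s ^+ 2 - 1) ^+ 2 * beta / (alpha ^+ 2 * s ^+ 6)).
case: adm => _ B1 _ _ [n1 n2]; rewrite /tau_formula /=.
split; rewrite ?oppr_eq0 //.
- by rewrite mul1r invr_eq0.
- rewrite mul1r sqrrN exprVn; apply: contraNneq B1 => e.
  by rewrite -[s ^+ 2]invrK e invr1.
- by rewrite !mulf_neq0 ?invr_eq0 ?mulf_neq0 ?expf_neq0 ?mulf_neq0.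
- rewrite /E1_eq; have -> : ((2 * s) ^+ 2 * (s ^+ 2 - 1) ^+ 2 * beta / (alpha ^+ 2 * s ^+ 6)) ^+ 2 =
    ((2 * s) ^+ 2 * (s ^+ 2 - 1) ^+ 2 / (alpha ^+ 2 * s ^+ 6)) ^+ 2 * beta ^+ 2.
    by field; rewrite s0 a0.
  by rewrite -eqE; field; rewrite s0 a0.
split; [apply: contraNneq n1 => e | apply: contraNneq n2 => e].
- rewrite -subr_eq0.
  have -> : alpha - 2 * s * (s + 1) ^+ 2 = alpha * s ^+ 3 / (2 * (s - 1) ^+ 2) *
    (- (1 / s ^+ 2) * (4 * (s ^+ 2 - 1) ^+ 2 / alpha) -
      2 * - (1 / s) * (- (1 / s) + 1) ^+ 2).
    by field; move: sm0; rewrite expf_eq0 /= s0 a0 => ->.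
  by rewrite e subrr mulr0.
- rewrite -subr_eq0.
  have -> : alpha - - 2 * s * (s - 1) ^+ 2 = - (alpha * s ^+ 3 / (2 * (s + 1) ^+ 2)) *
    (- (1 / s ^+ 2) * (4 * (s ^+ 2 - 1) ^+ 2 / alpha) -
      - 2 * - (1 / s) * (- (1 / s) - 1) ^+ 2).
    by field; move: sp0; rewrite expf_eq0 /= s0 a0 => ->.
  by rewrite e subrr mulr0.
Qed.

Let t := (F_formula (s, alpha)).1.
Let D := alpha + 2 * s ^+ 2 * (s ^+ 2 - 1).

Let st_sub : s - t = 2 * s * (s ^+ 2 - 1) * (s ^+ 2 + 1) / D.
Proof. by rewrite /t /D /=; field. Qed.

Let st_add : s + t = 2 * s * (alpha + (s ^+ 2 - 1) ^+ 2) / D.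
Proof. by rewrite /t /D /=; field. Qed.

Let st_mul1 : 1 + t * s = alpha * (s ^+ 2 + 1) / D.
Proof. by rewrite /t /D /=; field. Qed.

Let st_mulN1 : t * s - 1 = (alpha - (2 * s) ^+ 2) * (s ^+ 2 - 1) / D.
Proof. by rewrite /t /D /=; field. Qed.

(** For fixed s, t is a Moebius transformation of [alpha], here inverted. *)
Lemma admissible_recover :
  s != t /\ alpha = 2 * s * (s ^+ 2 - 1) * (1 + t * s) / (s - t).
Proof.
split; last by rewrite st_sub st_mul1; field; rewrite B0 s0 D0 C0.
by rewrite -subr_eq0 st_sub !mulf_neq0 ?invr_eq0.
Qed.

Lemma admissible_F : setB (F_formula (s, alpha)).
Proof.
have sinv : s - 1 / s != 0.
  have -> : s - 1 / s = (s ^+ 2 - 1) / s by field.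
  by rewrite mulf_neq0 ?invr_eq0.
have sinv' : s + 1 / s != 0.
  have -> : s + 1 / s = (s ^+ 2 + 1) / s by field.
  by rewrite mulf_neq0 ?invr_eq0.
have t0 : t != 0.
  rewrite /t /= -[2 * s * _]mulrA mulrCA -mulrBr !mulf_neq0 ?invr_eq0 //.
  exact: admissible_num.
case: adm => _ _ _ _ [n1 n2]; have [sp0 sm0] := pm0.
have tD : t * D = s * alpha - 2 * s * (s ^+ 2 - 1) by rewrite /t /D /=; field.
rewrite -[F_formula _]/(t, t ^+ 2 * (s - 1 / s) ^+ 2); split.
- split=> //; first by rewrite mulf_neq0 ?expf_neq0.
    (* The values 1 and -1 of t correspond to the two excluded values of [alpha]. *)
    apply: contraNneq n1 => t1; rewrite -subr_eq0.
    suff /eqP : (alpha - 2 * s * (s + 1) ^+ 2) * (s - 1) = 0.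
      by rewrite mulf_eq0 => /orP[//|sm]; move: sm0; rewrite expf_eq0 sm.
    by transitivity (t * D - D); [rewrite tD /D; ring | rewrite t1; ring].
  apply: contraNneq n2 => t1; rewrite -subr_eq0.
  suff /eqP : (alpha - - 2 * s * (s - 1) ^+ 2) * (s + 1) = 0.
    by rewrite mulf_eq0 => /orP[//|sp]; move: sp0; rewrite expf_eq0 sp.
  by transitivity (t * D + D); [rewrite tD /D; ring | rewrite t1; ring].
- by exists (t * (s - 1 / s)); [rewrite mulf_neq0 | exact: esym (exprMn _ _ _)].
- exists (2 * (s ^+ 2 - 1) * (s ^+ 2 + 1) * beta / D ^+ 2).
    rewrite !mulf_neq0 ?invr_eq0 ?expf_neq0 //.
  rewrite gammaB // st_sub st_add st_mul1 st_mulN1.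
  have -> : (2 * (s ^+ 2 - 1) * (s ^+ 2 + 1) * beta / D ^+ 2) ^+ 2 =
    (2 * (s ^+ 2 - 1) * (s ^+ 2 + 1) / D ^+ 2) ^+ 2 * beta ^+ 2 by field.
  by rewrite -eqE; field; rewrite s0 andbT; exact: D0.
- exists (t * (s + 1 / s)); first by rewrite mulf_neq0.
  by field.
Qed.

End Admissible.

(** * Invariance, image and fibres of F *)

Lemma admissible_inj s alpha beta alpha' beta' :
  admissible s alpha beta -> admissible s alpha' beta' ->
  F_formula (s, alpha) = F_formula (s, alpha') -> alpha = alpha'.
Proof.
move=> adm adm' e.
have [_ ->] := admissible_recover adm; have [_ ->] := admissible_recover adm'.
by rewrite e.
Qed.

Lemma F_formula_eq s alpha s' alpha' :
  (F_formula (s, alpha)).1 = (F_formula (s', alpha')).1 ->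
  (s - 1 / s) ^+ 2 = (s' - 1 / s') ^+ 2 ->
  F_formula (s, alpha) = F_formula (s', alpha').
Proof. by rewrite /F_formula /= => -> ->. Qed.

Lemma F_sigma s alpha beta : admissible s alpha beta ->
  F_formula (sigma_formula (s, alpha)) = F_formula (s, alpha).
Proof.
move=> adm; have [beta' adm'] := admissible_sigma adm.
have d0 := admissible_den adm; have d0' := admissible_den adm'.
have [s0 _ _ _ _] := adm; have [_ _ b0] := admissible_factors adm.
rewrite /sigma_formula /= in d0'.
apply: F_formula_eq => /=; last by field.
by apply/eqP; rewrite eqr_div //; apply/eqP; field.
Qed.

Lemma F_tau s alpha beta : admissible s alpha beta ->
  F_formula (tau_formula (s, alpha)) = F_formula (s, alpha).
Proof.
move=> adm; have [beta' adm'] := admissible_tau adm.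
have d0 := admissible_den adm; have d0' := admissible_den adm'.
have [s0 _ _ _ _] := adm; have [a0 _ _] := admissible_factors adm.
rewrite /tau_formula /= in d0'.
apply: F_formula_eq => /=; last by field.
by apply/eqP; rewrite eqr_div //; apply/eqP; field; rewrite s0 a0.
Qed.

Lemma sigma_involutive s alpha beta : admissible s alpha beta ->
  sigma_formula (sigma_formula (s, alpha)) = (s, alpha).
Proof.
move=> adm; have [beta' adm'] := admissible_sigma adm.
have [s0 s2 _ _ _] := adm; have [_ _ b0] := admissible_factors adm.
have [_ _ /= b0'] := admissible_factors adm'.
have B0 : s ^+ 2 - 1 != 0 by rewrite subr_eq0.
have C0 : s ^+ 2 + 1 != 0 by rewrite gt_eqF // ltr_wpDl ?sqr_ge0.
rewrite /sigma_formula opprK; congr pair; rewrite !sqrrN.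
rewrite mulrA; apply: (mulIf b0'); rewrite sqrrN divfK; last by rewrite sqrrN in b0'.
by field.
Qed.

Lemma tau_involutive s alpha beta : admissible s alpha beta ->
  tau_formula (tau_formula (s, alpha)) = (s, alpha).
Proof.
move=> adm; have [s0 s2 _ _ _] := adm; have [a0 _ _] := admissible_factors adm.
have B0 : s ^+ 2 - 1 != 0 by rewrite subr_eq0.
have B0' : 1 - s ^+ 2 != 0 by rewrite subr_eq0 eq_sym.
by rewrite /tau_formula; congr pair; field; rewrite ?s0 ?a0 ?B0.
Qed.

Lemma sigma_tauC s alpha beta : admissible s alpha beta ->
  sigma_formula (tau_formula (s, alpha)) = tau_formula (sigma_formula (s, alpha)).
Proof.
move=> adm; have [beta' adm'] := admissible_sigma adm.
have [beta'' adm''] := admissible_tau adm.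
have [s0 s2 _ _ _] := adm; have [a0 am0 b0] := admissible_factors adm.
have [_ _ /= b0''] := admissible_factors adm''.
have B0 : s ^+ 2 - 1 != 0 by rewrite subr_eq0.
rewrite /tau_formula /sigma_formula; congr pair; first by field.
rewrite mulrA; apply: (mulIf b0''); rewrite divfK //.
by field; rewrite s0 a0 b0 am0 B0.
Qed.

Lemma admissible_surj t g : setB (t, g) ->
  exists s alpha beta, admissible s alpha beta /\ F_formula (s, alpha) = (t, g).
Proof.
move=> [[t0 g0 t1 tN1] [r r0 er] [k k0 ek] [h h0 eh]].
(* Solves r = t (s - 1/s) and h = t (s + 1/s), whose sum is 2 t s. *)
pose s := (r + h) / (2 * t).
have s0 : s != 0.
  rewrite mulf_neq0 ?invr_eq0 ?mulf_neq0 // addr_eq0; apply/eqP => e.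
  have : (2 * t) ^+ 2 != 0 by rewrite expf_neq0 ?mulf_neq0.
  by move/negP; apply; apply/eqP; rewrite -[LHS](addKr g) eh er e sqrrN addNr.
have es : s - 1 / s = r / t.
  have hh : h ^+ 2 = r ^+ 2 + 4 * t ^+ 2 by rewrite -eh er; ring.
  have rh0 : r + h != 0 by move: s0; rewrite mulf_eq0 negb_or => /andP[].
  apply/eqP; rewrite -subr_eq0; apply/eqP.
  have -> : s - 1 / s - r / t = (h ^+ 2 - r ^+ 2 - 4 * t ^+ 2) / (2 * t * (r + h)).
    by rewrite /s; field; rewrite t0 rh0.
  by rewrite hh; field; rewrite t0 rh0.
clearbody s.
have B0 : s ^+ 2 - 1 != 0.
  have -> : s ^+ 2 - 1 = s * (s - 1 / s) by field.
  by rewrite es !mulf_neq0 ?invr_eq0.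
have C0 : s ^+ 2 + 1 != 0 by rewrite gt_eqF // ltr_wpDl ?sqr_ge0.
have eg : g = t ^+ 2 * (s - 1 / s) ^+ 2 by rewrite er es; field.
have ek' : k ^+ 2 = (1 + t * s) * (t * s - 1) * (s + t) * (s - t) / s ^+ 2.
  by rewrite -ek eg gammaB.
have : (1 + t * s) * (t * s - 1) * (s + t) * (s - t) / s ^+ 2 != 0.
  by rewrite -ek' expf_neq0.
rewrite !mulf_eq0 !negb_or -!andbA => /and5P[p1 p2 p3 p4 _].
(* [alpha] is taken from [admissible_recover]; [beta] solves k = 2 (s^2 - 1)(s^2 + 1) beta / D^2,
   the root in [admissible_F], with D the denominator of t. *)
pose alpha := 2 * s * (s ^+ 2 - 1) * (1 + t * s) / (s - t).
pose beta := 2 * s ^+ 2 * (s ^+ 2 - 1) * (s ^+ 2 + 1) * k / (s - t) ^+ 2.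
exists s, alpha, beta; split.
  split=> //; first by rewrite -subr_eq0.
  - by rewrite !mulf_neq0 ?invr_eq0 ?expf_neq0.
  - rewrite /E1_eq; have -> : beta ^+ 2 =
      (2 * s ^+ 2 * (s ^+ 2 - 1) * (s ^+ 2 + 1) / (s - t) ^+ 2) ^+ 2 * k ^+ 2.
      by rewrite /beta; field.
    by rewrite ek' /alpha; field; rewrite s0.
  have [sp0 sm0] : s + 1 != 0 /\ s - 1 != 0.
    by apply/andP; rewrite -negb_or -mulf_eq0 mulrC -subr_sqr_1.
  split; apply/eqP => e.
  - have : (t - 1) * ((s ^+ 2 + 1) * (2 * s * (s + 1))) =
        (alpha - 2 * s * (s + 1) ^+ 2) * (s - t) by rewrite /alpha; field.
    rewrite e subrr mul0r; apply/eqP.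
    by rewrite !mulf_neq0 // subr_eq0.
  - have : (t + 1) * ((s ^+ 2 + 1) * (2 * s * (s - 1))) =
        (alpha - - 2 * s * (s - 1) ^+ 2) * (s - t) by rewrite /alpha; field.
    rewrite e subrr mul0r; apply/eqP.
    by rewrite !mulf_neq0 // addr_eq0.
have De : alpha + 2 * s ^+ 2 * (s ^+ 2 - 1) = 2 * s * (s ^+ 2 - 1) * (s ^+ 2 + 1) / (s - t).
  by rewrite /alpha; field.
rewrite eg /F_formula; have -> : (s * alpha - 2 * s * (s ^+ 2 - 1)) /
    (alpha + 2 * s ^+ 2 * (s ^+ 2 - 1)) = t; last by [].
by rewrite De /alpha; field; rewrite s0 p4 B0 C0.
Qed.

(** Since gamma / t^2 = (s - 1/s)^2, s' is one of s, -s, -1/s, 1/s, the first coordinates of the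
    four images; then t determines alpha' by [admissible_inj]. *)
Lemma F_fiber s alpha beta s' alpha' beta' :
  admissible s alpha beta -> admissible s' alpha' beta' ->
  F_formula (s', alpha') = F_formula (s, alpha) ->
  [\/ (s', alpha') = (s, alpha), (s', alpha') = sigma_formula (s, alpha),
      (s', alpha') = tau_formula (s, alpha) |
      (s', alpha') = sigma_formula (tau_formula (s, alpha))].
Proof.
move=> adm adm' eF.
have [s0 _ _ _ _] := adm; have [s0' _ _ _ _] := adm'.
have same p b : admissible p.1 p.2 b -> F_formula p = F_formula (s, alpha) ->
    s' = p.1 -> (s', alpha') = p.
  case: p => s1 a1 /= admp eFp es; rewrite es in adm' eF *.
  by congr pair; apply: (admissible_inj adm' admp); exact: etrans eF (esym eFp).
have [bs adms] := admissible_sigma adm; have [bt admt] := admissible_tau adm.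
have [bst admst] : exists b, admissible (sigma_formula (tau_formula (s, alpha))).1
    (sigma_formula (tau_formula (s, alpha))).2 b by apply: admissible_sigma admt.
have eFs := F_sigma adm; have eFt := F_tau adm.
have eFst : F_formula (sigma_formula (tau_formula (s, alpha))) = F_formula (s, alpha).
  by rewrite -eFt; apply: F_sigma admt.
have t0 : (F_formula (s, alpha)).1 != 0 by have [[]] := admissible_F adm.
have : (s' - s) * (s' + s) * (s' - - (1 / s)) * (s' - 1 / s) = 0.
  have e : (s' - 1 / s') ^+ 2 = (s - 1 / s) ^+ 2.
    have := congr1 snd eF; have := congr1 fst eF; rewrite /= => -> h.
    by apply: (mulfI (_ : (F_formula (s, alpha)).1 ^+ 2 != 0)); rewrite // expf_neq0.
  transitivity (((s' - 1 / s') ^+ 2 - (s - 1 / s) ^+ 2) * s' ^+ 2).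
    by field; rewrite s0 s0'.
  by rewrite e subrr mul0r.
move/eqP; rewrite !mulf_eq0 !subr_eq0 addr_eq0 => /orP[/orP[/orP[]|]|] /eqP es.
- by apply: Or41; apply: (same (s, alpha) _ adm).
- by apply: Or42; apply: (same _ _ adms).
- by apply: Or43; apply: (same _ _ admt).
- apply: Or44; apply: (same _ _ admst) => //.
  by rewrite es /= opprK.
Qed.

(** A point of [setA] ensures that Gamma has four elements: on an empty set all maps coincide. *)
Lemma admissible_example :
  admissible (1 / 9) (5 / 9) (5 * 7 * 41 / (3 * 9 ^+ 3)).
Proof.
split; last by split.
- by [].
- by [].
- by apply: lt0r_neq0; lra.
- by rewrite /E1_eq; lra.
Qed.

(** * The maps on A and B *)

Lemma setA_admissible (a : setA) : exists beta, admissible (val a).1 (val a).2 beta.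
Proof. by apply/setAP; have := set_valP a; case: (val a). Qed.

Lemma sigma_setA (a : setA) : setA (sigma_formula (val a)).
Proof.
have [b adm] := setA_admissible a; have [b' adm'] := admissible_sigma adm.
by move: adm'; case: (val a) => s al adm'; apply/setAP; exists b'.
Qed.

Lemma tau_setA (a : setA) : setA (tau_formula (val a)).
Proof.
have [b adm] := setA_admissible a; have [b' adm'] := admissible_tau adm.
by move: adm'; case: (val a) => s al adm'; apply/setAP; exists b'.
Qed.

Lemma F_setB (a : setA) : setB (F_formula (val a)).
Proof.
have [b adm] := setA_admissible a.
by move: adm; case: (val a) => s al adm; apply: admissible_F adm.
Qed.

Definition sigma (a : setA) : setA := SigSub (mem_set (sigma_setA a)).
Definition tau (a : setA) : setA := SigSub (mem_set (tau_setA a)).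
Definition Fmap (a : setA) : setB := SigSub (mem_set (F_setB a)).

Lemma setA_pair (a : setA) : exists s alpha beta,
  val a = (s, alpha) /\ admissible s alpha beta.
Proof.
have [b] := setA_admissible a; case: (val a) => s al adm.
by exists s, al, b.
Qed.

Lemma sigmaK : involutive sigma.
Proof.
move=> a; apply: val_inj => /=; have [s [al [b [-> adm]]]] := setA_pair a.
exact: sigma_involutive adm.
Qed.

Lemma tauK : involutive tau.
Proof.
move=> a; apply: val_inj => /=; have [s [al [b [-> adm]]]] := setA_pair a.
exact: tau_involutive adm.
Qed.

Lemma sigmaC a : sigma (tau a) = tau (sigma a).
Proof.
apply: val_inj => /=; have [s [al [b [-> adm]]]] := setA_pair a.
exact: sigma_tauC adm.
Qed.

Lemma Fmap_sigma a : Fmap (sigma a) = Fmap a.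
Proof.
apply: val_inj => /=; have [s [al [b [-> adm]]]] := setA_pair a.
exact: F_sigma adm.
Qed.

Lemma Fmap_tau a : Fmap (tau a) = Fmap a.
Proof.
apply: val_inj => /=; have [s [al [b [-> adm]]]] := setA_pair a.
exact: F_tau adm.
Qed.

Lemma Fmap_fiber a a' : Fmap a' = Fmap a ->
  [\/ a' = a, a' = sigma a, a' = tau a | a' = sigma (tau a)].
Proof.
move=> /(congr1 val) /=; have [s [al [b [e adm]]]] := setA_pair a.
have [s' [al' [b' [e' adm']]]] := setA_pair a'.
rewrite e e' => /(F_fiber adm adm') [] h.
- by apply: Or41; apply: val_inj; rewrite /= e e'.
- by apply: Or42; apply: val_inj; rewrite /= e e'.
- by apply: Or43; apply: val_inj; rewrite /= e e'.
- by apply: Or44; apply: val_inj; rewrite /= e e'.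
Qed.

Lemma Fmap_surj b : exists a, Fmap a = b.
Proof.
have := set_valP b; case eb : (val b) => [t g] => /admissible_surj.
case=> s [al [be [adm eF]]].
have inA : setA (s, al) by apply/setAP; exists be.
by exists (SigSub (mem_set inA)); apply: val_inj; rewrite eb; apply: eF.
Qed.

(** * Commuting involutions and orbit spaces *)

Section InvolutionPair.
Variables (T : Type) (f g : T -> T).
Hypotheses (fK : involutive f) (gK : involutive g) (fgC : forall a, f (g a) = g (f a)).

Definition klein_map (u : 'Z_2 * 'Z_2) : T -> T :=
  (if u.1 == 0 then id else f) \o (if u.2 == 0 then id else g).

Lemma Z2P (a : 'Z_2) : a = 0 \/ a = 1.
Proof. by case: a => [[|[|]]] //= lt; [left|right]; apply: val_inj. Qed.

Lemma klein_mapP h : range klein_map h <-> [\/ h = id, h = f, h = g | h = f \o g].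
Proof.
split=> [[[u1 u2] _ <-]|].
  rewrite /klein_map; case: (Z2P u1) => ->; case: (Z2P u2) => -> /=;
    [exact: Or41|exact: Or43|exact: Or42|exact: Or44].
by case=> ->; [exists (0, 0)|exists (1, 0)|exists (0, 1)|exists (1, 1)].
Qed.

Lemma klein_mapD u v : klein_map (u + v) = klein_map u \o klein_map v.
Proof.
apply/funext => a; case: u v => [u1 u2] [v1 v2]; rewrite /klein_map /=.
by case: (Z2P u1) => ->; case: (Z2P u2) => ->; case: (Z2P v1) => ->;
  case: (Z2P v2) => ->; rewrite /= ?fgC ?fK ?gK ?fK.
Qed.

Lemma Z2xZ2_double (v : 'Z_2 * 'Z_2) : v + v = 0.
Proof.
case: v => [v1 v2]; congr pair.
  by case: (Z2P v1) => ->; apply: val_inj.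
by case: (Z2P v2) => ->; apply: val_inj.
Qed.

Lemma klein_group : bijection_group (range klein_map).
Proof.
split; first by exists 0.
  by move=> _ _ [u _ <-] [v _ <-]; exists (u + v) => //; rewrite klein_mapD.
move=> _ [u _ <-]; exists (klein_map u); first by exists u.
suff uK : involutive (klein_map u) by split.
by move=> a; rewrite -[LHS]/((klein_map u \o klein_map u) a) -klein_mapD Z2xZ2_double.
Qed.

Lemma generated_klein : generated_group [set f; g]%classic = range klein_map.
Proof.
apply/seteqP; split=> h.
  apply; split; first exact: klein_group.
  by move=> k [->|->]; apply/klein_mapP; [exact: Or42|exact: Or43].
move=> /klein_mapP kh G [[Gid Gcomp _] Gfg].
have Gf : G f by apply: Gfg; left.
have Gg : G g by apply: Gfg; right.
by case: kh => -> //; apply: Gcomp.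
Qed.

(** Every element is its own inverse, so injectivity reduces to a trivial kernel, which the single
    point [a] detects. *)
Lemma klein_iso a : f a <> a -> g a <> a -> f (g a) <> a ->
  isomorphic_Z2xZ2 (range klein_map).
Proof.
move=> fa ga fga; exists klein_map; split=> //; last exact: klein_mapD.
have fix0 u : klein_map u a = a -> u = 0.
  case: u => [u1 u2]; rewrite /klein_map.
  by case: (Z2P u1) => ->; case: (Z2P u2) => ->.
move=> u v e; rewrite -[u]addr0 -(Z2xZ2_double v) addrA.
have -> : u + v = 0 by apply: fix0; rewrite klein_mapD e -klein_mapD Z2xZ2_double.
by rewrite add0r.
Qed.

End InvolutionPair.

(** [Fbar] evaluates F at a chosen representative; its inverse takes the orbit of a chosen
    preimage. *)
Lemma orbit_space_bijection (T U : Type) (G : set (T -> T)) (F : T -> U) :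
  (forall a a', map_orbit G a = map_orbit G a' <-> F a = F a') ->
  (forall b, exists a, F a = b) ->
  exists Fbar : orbit_space G -> U,
    (forall a, Fbar (orbit_class G a) = F a) /\ bijective Fbar.
Proof.
move=> orbF surjF.
have rep (o : orbit_space G) : exists a, orbit_class G a = o.
  have [a _ e] := set_valP o; exists a; exact: val_inj.
pose Fbar o := F (projT1 (cid (rep o))).
have FbarE a : Fbar (orbit_class G a) = F a.
  by rewrite /Fbar; case: cid => a' /= /(congr1 val) /= /orbF.
exists Fbar; split=> //.
exists (fun b => orbit_class G (projT1 (cid (surjF b)))) => [o|b].
  have [a <-] := rep o; rewrite FbarE; case: cid => a' /= /orbF e.
  exact: val_inj.
by rewrite FbarE; case: cid.
Qed.

Theorem theorem3p2 :
  exists (sigma tau : setA -> setA) (F : setA -> setB),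
    [/\ forall a, val (sigma a) = sigma_formula (val a),
        forall a, val (tau a) = tau_formula (val a) &
        forall a, val (F a) = F_formula (val a)] /\
    let Gamma := generated_group [set sigma; tau] in
    [/\ isomorphic_Z2xZ2 Gamma /\ bijection_group Gamma,
        forall rho, Gamma rho -> F \o rho = F &
        exists Fbar : orbit_space Gamma -> setB,
          (forall a, Fbar (orbit_class Gamma a) = F a) /\ bijective Fbar].
Proof.
exists sigma, tau, Fmap; split; first by split.
have := klein_group sigmaK tauK sigmaC.
have := @klein_mapP _ sigma tau; have := @klein_iso _ _ _ sigmaK tauK sigmaC.
rewrite (generated_klein sigmaK tauK sigmaC).
move: (range _) => Gamma isoG memG groupG; cbv zeta.
have invF rho : Gamma rho -> Fmap \o rho = Fmap.
  move/memG => kr; apply/funext => a /=.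
  by case: kr => -> //=; rewrite ?Fmap_sigma ?Fmap_tau.
have inA : setA (1 / 9, 5 / 9) by apply/setAP; eexists; exact: admissible_example.
pose a0 : setA := SigSub (mem_set inA).
(* sigma, tau and their product send s = 1/9 to -1/9, -9 and 9, so first coordinates suffice to see
   that [a0] moves. *)
have ne (a : setA) : (val a).1 != (val a0).1 -> a <> a0.
  by move=> /eqP h e; apply: h; rewrite e.
split=> //; first by split=> //; apply: (isoG a0); apply: ne.
apply: orbit_space_bijection Fmap_surj => a a'; have [Gid Gcomp Ginv] := groupG.
split=> [e|/esym e].
  have : map_orbit Gamma a' a by rewrite -e; exists id.
  by move=> [rho kr <-]; rewrite -[LHS]/((Fmap \o rho) a') invF.
have [rho Grho ->] : exists2 rho, Gamma rho & a' = rho a.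
  by case: (Fmap_fiber e) => ->; [exists id|exists sigma|exists tau|exists (sigma \o tau)];
    rewrite ?memG; constructor.
have [rho' Grho' [rhoK _]] := Ginv _ Grho.
apply/seteqP; split=> _ [h Gh <-].
  by exists (h \o rho'); [exact: Gcomp | rewrite /= rhoK].
by exists (h \o rho); [exact: Gcomp | ].
Qed.
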